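(* There is a constant $C>0$, independent of $h$, $N$, $n$ and $U^0$, such that for each $n=1,\dots,N$ the fully-discrete solution $U^n$ (defined in the context) satisfies $$\|U^n\|\le C\,(1+\|U^0\|),\qquad \|\nabla U^n\|\le C\,(1+\|\nabla U^0\|).$$
   Context: Parameters: $T>0$, $m,N\in\mathbb{N}$, $\mu_s>0$ for $s=1,\dots,m$, $0<\alpha_m<\dots<\alpha_1<1$. Continuous problem: $\Omega\subseteq\mathbb{R}^d$ ($d=1$ or $2$) is a bounded domain with smooth boundary; $\sum_{s=1}^m\mu_s\,{}^c_0D^{\alpha_s}_tu-a(l(u))\Delta u=f$ in $\Omega\times(0,T]$, $u=0$ on $\partial\Omega\times(0,T]$, $u(\cdot,0)=u_0$ in $\Omega$, where ${}^c_0D^{\alpha_s}_t$ is the Caputo derivative of order $\alpha_s$ and $l(w)=\int_\Omega w\,dx$. Standing hypotheses: there are $m_1,m_2>0$ with $0<m_1\le a(x)\le m_2<\infty$ for all $x\in\mathbb{R}$; $a:\mathbb{R}\to\mathbb{R}$ is Lipschitz continuous, $|a(x_1)-a(x_2)|\le L|x_1-x_2|$; $f\in L^2(0,T;L^2(\Omega))$ and $u_0\in H^1_0(\Omega)\cap H^2(\Omega)$. Here $(\cdot,\cdot)$ and $\|\cdot\|$ are the $L^2(\Omega)$ inner product and norm. Spatial discretization: $V_h\subset H^1_0(\Omega)$ is the finite-dimensional space of continuous piecewise linear polynomials on a quasi-uniform partition of $\Omega$ into intervals ($d=1$) or triangles ($d=2$) of mesh size $h$. Graded mesh: $t_n=T(n/N)^r$,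 $n=0,\dots,N$, with fixed grading parameter $r\ge1$; $\tau_n=t_n-t_{n-1}$; $t_{j-1/2}=\frac12(t_{j-1}+t_j)$. Shift parameters: for $n=1,\dots,N$ let $\sigma_n^\star$ be the unique root in $[1-\frac{\alpha_1}{2},1-\frac{\alpha_m}{2}]$ of $\mathcal{G}_n(\sigma)=\sum_{s=1}^m\frac{\mu_s}{\Gamma(3-\alpha_s)}\sigma^{1-\alpha_s}\big[\sigma-(1-\frac{\alpha_s}{2})\big]\tau_n^{2-\alpha_s}$, and put $\sigma_n=1-\sigma_n^\star$, $t_{n-\sigma_n}=(1-\sigma_n)t_n+\sigma_nt_{n-1}$, $v^{n,\sigma_n}=(1-\sigma_n)v^n+\sigma_nv^{n-1}$, $f^{n-\sigma_n}=f(\cdot,t_{n-\sigma_n})$, and for $n\ge2$, $\widehat v^{\,n-\sigma_n}=\frac{\tau_{n-1}+(1-\sigma_n)\tau_n}{\tau_{n-1}}v^{n-1}-\frac{(1-\sigma_n)\tau_n}{\tau_{n-1}}v^{n-2}$. Coefficients: $a^{(\alpha_s,\sigma_n)}_{n,n}=\frac{1}{\Gamma(1-\alpha_s)}\int_{t_{n-1}}^{t_{n-\sigma_n}}(t_{n-\sigma_n}-\eta)^{-\alpha_s}d\eta$ and, for $1\le j\le n-1$, $a^{(\alpha_s,\sigma_n)}_{n,j}=\frac{1}{\Gamma(1-\alpha_s)}\int_{t_{j-1}}^{t_j}(t_{n-\sigma_n}-\eta)^{-\alpha_s}d\eta$, $b^{(\alpha_s,\sigma_n)}_{n,j}=\frac{2}{\Gamma(1-\alpha_s)(t_{j+1}-t_{j-1})}\int_{t_{j-1}}^{t_j}(t_{n-\sigma_n}-\eta)^{-\alpha_s}(\eta-t_{j-1/2})d\eta$.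 Then $g^{(\alpha_s,\sigma_1)}_{1,1}=\tau_1^{-1}a^{(\alpha_s,\sigma_1)}_{1,1}$ and, for $n\ge2$, $g^{(\alpha_s,\sigma_n)}_{n,1}=\tau_1^{-1}(a^{(\alpha_s,\sigma_n)}_{n,1}-b^{(\alpha_s,\sigma_n)}_{n,1})$; $g^{(\alpha_s,\sigma_n)}_{n,j}=\tau_j^{-1}(a^{(\alpha_s,\sigma_n)}_{n,j}+b^{(\alpha_s,\sigma_n)}_{n,j-1}-b^{(\alpha_s,\sigma_n)}_{n,j})$ for $2\le j\le n-1$; $g^{(\alpha_s,\sigma_n)}_{n,n}=\tau_n^{-1}(a^{(\alpha_s,\sigma_n)}_{n,n}+b^{(\alpha_s,\sigma_n)}_{n,n-1})$. Set $g_{n,j}=\sum_{s=1}^m\mu_s\,g^{(\alpha_s,\sigma_n)}_{n,j}$ and $D_Nv^{n-\sigma_n}:=\sum_{j=1}^ng_{n,j}(v^j-v^{j-1})$. Fully-discrete scheme: $U^0=u_h^0\in V_h$, where $u^0_h$ is some approximation of $u_0$, and for $n=1,\dots,N$, $U^n\in V_h$ satisfies for all $v_h\in V_h$ $$(D_NU^{1-\sigma_1},v_h)+a(l(U^{1,\sigma_1}))(\nabla U^{1,\sigma_1},\nabla v_h)=(f^{1-\sigma_1},v_h),$$ $$(D_NU^{n-\sigma_n},v_h)+a(l(\widehat U^{\,n-\sigma_n}))(\nabla U^{n,\sigma_n},\nabla v_h)=(f^{n-\sigma_n},v_h)\quad(n\ge2).$$ The constant $C$ may depend on $T$, $m$,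 the $\alpha_s$, the $\mu_s$, $m_1$, and on $f$ through $\max_{1\le j\le N}\|f^{j-\sigma_j}\|$ (the values $f(\cdot,t_{n-\sigma_n})\in L^2(\Omega)$ are understood to be defined). *)

(* Defs.v *)
From HB Require Import structures.
From mathcomp Require Import all_boot all_order all_algebra.
From mathcomp Require Import all_classical all_reals all_analysis.

Set Implicit Arguments.
Unset Strict Implicit.
Unset Printing Implicit Defensive.

Import Order.TTheory GRing.Theory Num.Theory.
Import numFieldNormedType.Exports.

Local Open Scope classical_set_scope.
Local Open Scope ring_scope.

Definition rV_display : measure_display. Proof. exact: default_measure_display. Qed.

Section rV_measurable.
Context (R : realType) (d : nat).

(* The sigma-algebra generated by the coordinates, i.e., the Borel sets. *)
Definition rV_coord (i : 'I_d) (x : 'rV[R]_d) : measurableTypeR R := x ord0 i.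

Let rV_set0 : g_sigma_preimage rV_coord set0.
Proof. exact: sigma_algebra0. Qed.

Let rV_setC A : g_sigma_preimage rV_coord A -> g_sigma_preimage rV_coord (~` A).
Proof. exact: sigma_algebraC. Qed.

Let rV_bigcup (F : _^nat) : (forall i, g_sigma_preimage rV_coord (F i)) ->
  g_sigma_preimage rV_coord (\bigcup_i (F i)).
Proof. exact: sigma_algebra_bigcup. Qed.

HB.instance Definition _ := @isMeasurable.Build rV_display
  'rV[R]_d (g_sigma_preimage rV_coord) rV_set0 rV_setC rV_bigcup.

Lemma measurable_to_rV d' (T : measurableType d') (f : T -> 'rV[R]_d) :
  (forall i, measurable_fun setT (fun t => rV_coord i (f t))) ->
  measurable_fun setT f.
Proof.
move=> mf; suff H : g_sigma_preimage (fun i => rV_coord i \o f) `<=` measurable.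
  move=> _ A mA; rewrite setTI; apply: H.
  rewrite (g_sigma_preimage_comp rV_coord f).
  by exists A => //; rewrite setTI.
apply: smallest_sub; first exact: sigma_algebra_measurable.
elim/big_ind : _ => [//|A B sA sB X [/sA//|/sB//]|i _ A [B mB <-]].
exact: mf.
Qed.

End rV_measurable.

Section lebesgue_rV.
Context (R : realType) (d : nat).

(* Isomorphisms onto R^d for d = 1 and d = 2 respectively. *)
Definition rV_of1 (x : measurableTypeR R) : 'rV[R]_d := \row_(i < d) x.

Definition rV_of2 (p : measurableTypeR R * measurableTypeR R) : 'rV[R]_d :=
  \row_(i < d) (if i == 0%N :> nat then p.1 else p.2).

Lemma measurable_rV_of1 : measurable_fun setT rV_of1.
Proof.
apply: measurable_to_rV => i.
rewrite (_ : (fun _ => _) = id) //; apply/funext => x.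
by rewrite /rV_coord mxE.
Qed.

Lemma measurable_rV_of2 : measurable_fun setT rV_of2.
Proof.
apply: measurable_to_rV => i.
rewrite (_ : (fun _ => _) = if i == 0%N :> nat then fst else snd); last first.
  by apply/funext => p; rewrite /rV_coord mxE; case: ifP.
by case: ifP => _; [exact: measurable_fst|exact: measurable_snd].
Qed.

(* The value 0 for other d is a dummy: only d = 1, 2 are ever considered. *)
Definition lebesgue_rV : set 'rV[R]_d -> \bar R :=
  match d with
  | 1 => pushforward (@lebesgue_measure R) rV_of1
  | 2 => pushforward (@lebesgue_measure R \x @lebesgue_measure R)%E rV_of2
  | _ => mzero
  end.

Let lebesgue_rV_measure : exists mu : {measure set 'rV[R]_d -> \bar R},
  lebesgue_rV = mu.
Proof.
rewrite /lebesgue_rV; move: measurable_rV_of1 measurable_rV_of2.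
set f1 := rV_of1; set f2 := rV_of2 => m1 m2.
clearbody f1 f2.
case: (d) f1 f2 m1 m2 => [|[|[|n]]] f1 f2 m1 m2.
- by exists mzero.
- pose mu : {measure set 'rV[R]_1 -> \bar R} :=
    measure_function_pushforward__canonical__measure_function_Measure
      (@lebesgue_measure R) m1.
  by exists mu.
- pose mu : {measure set 'rV[R]_2 -> \bar R} :=
    measure_function_pushforward__canonical__measure_function_Measure
      (@lebesgue_measure R \x @lebesgue_measure R)%E m2.
  by exists mu.
- by exists mzero.
Qed.

Let lebesgue_rV0 : lebesgue_rV set0 = 0%E.
Proof. by have [mu ->] := lebesgue_rV_measure. Qed.

Let lebesgue_rV_ge0 A : (0 <= lebesgue_rV A)%E.
Proof. by have [mu ->] := lebesgue_rV_measure. Qed.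

Let lebesgue_rV_semi_sigma_additive : semi_sigma_additive lebesgue_rV.
Proof.
by have [mu ->] := lebesgue_rV_measure; exact: measure_semi_sigma_additive.
Qed.

HB.instance Definition _ := isMeasure.Build _ _ _ lebesgue_rV
  lebesgue_rV0 lebesgue_rV_ge0 lebesgue_rV_semi_sigma_additive.

End lebesgue_rV.

Arguments lebesgue_rV {R} d.

Section spaces.
Context (R : realType) (d : nat).
Implicit Types (Omega B : set 'rV[R]_d) (u v : 'rV[R]_d -> R).

(* The library norm on 'rV[R]_d is the max norm. *)
Definition enorm (x : 'rV[R]_d) : R := Num.sqrt (\sum_(i < d) x ord0 i ^+ 2).

Definition partial (i : 'I_d) v : 'rV[R]_d -> R :=
  fun x => 'D_(delta_mx ord0 i) v x.

Definition smooth_on B v : Prop :=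
  forall (s : seq 'I_d) x, B x -> differentiable (foldr partial v s) x.

Definition bdry Omega : set 'rV[R]_d := closure Omega `\` interior Omega.

(* The boundary is locally the zero set of a smooth function with nonvanishing
   gradient, with Omega on one side of it. *)
Definition smooth_boundary Omega : Prop :=
  forall x, bdry Omega x ->
    exists B (phi : 'rV[R]_d -> R),
      [/\ open B, B x, smooth_on B phi,
          forall y, B y -> exists i, partial i phi y != 0 &
          B `&` Omega = B `&` [set y | phi y < 0]].

Definition smooth_bounded_domain Omega : Prop :=
  [/\ Omega !=set0, open Omega, connected Omega, bounded_set Omega &
      smooth_boundary Omega].

Definition L2 Omega u : Prop :=
  measurable_fun Omega u /\
  (\int[lebesgue_rV d]_(x in Omega) ((u x) ^+ 2)%:E < +oo)%E.

Definition dotL2 Omega u v : R := \int[lebesgue_rV d]_(x in Omega) (u x * v x).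

Definition normL2 Omega u : R := Num.sqrt (dotL2 Omega u u).

(* (grad u, grad v), with the classical gradients, which for the piecewise
   linear functions below exist almost everywhere and are the weak ones. *)
Definition dot_grad Omega u v : R :=
  \int[lebesgue_rV d]_(x in Omega) \sum_(i < d) partial i u x * partial i v x.

Definition norm_grad Omega u : R := Num.sqrt (dot_grad Omega u u).

Definition test_function Omega v : Prop :=
  smooth_on setT v /\
  exists2 K, compact K /\ K `<=` Omega & forall x, ~ K x -> v x = 0.

Definition weak_partial Omega (i : 'I_d) u g : Prop :=
  forall phi, test_function Omega phi ->
    dotL2 Omega u (partial i phi) = - dotL2 Omega g phi.

(* The closure of the test functions in H^1(Omega). *)
Definition H10 Omega u : Prop :=
  L2 Omega u /\
  exists (g : 'I_d -> 'rV[R]_d -> R) (phi : nat -> 'rV[R]_d -> R),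
    [/\ forall i, L2 Omega (g i), forall k, test_function Omega (phi k),
        (fun k => normL2 Omega (phi k \- u)) @ \oo --> (0 : R) &
        forall i, (fun k => normL2 Omega (partial i (phi k) \- g i)) @ \oo
                  --> (0 : R)].

Definition H2 Omega u : Prop :=
  L2 Omega u /\
  exists (g : 'I_d -> 'rV[R]_d -> R) (H : 'I_d -> 'I_d -> 'rV[R]_d -> R),
    [/\ forall i, L2 Omega (g i), forall i, weak_partial Omega i u (g i),
        forall i j, L2 Omega (H i j) &
        forall i j, weak_partial Omega j (g i) (H i j)].

(* L^2(0, T; L^2(Omega)), identified with L^2((0, T) x Omega) *)
Definition L2_time (T : R) Omega (f : R -> 'rV[R]_d -> R) : Prop :=
  measurable_fun (`]0, T[%classic `*` Omega)
    (fun p : measurableTypeR R * 'rV[R]_d => f p.1 p.2) /\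
  (\int[@lebesgue_measure R]_(t in `]0%R, T[%classic)
     \int[lebesgue_rV d]_(x in Omega) ((f t x) ^+ 2)%:E < +oo)%E.

End spaces.

Section finite_elements.
Context (R : realType) (d : nat).

(* A d-simplex is given by its vertices, the rows of a (d+1) x d matrix. *)
Definition hull_of (S : 'M[R]_(d.+1, d)) (F : pred 'I_d.+1) : set 'rV[R]_d :=
  [set x | exists2 c : 'rV[R]_d.+1,
     [/\ forall i, 0 <= c ord0 i, forall i, ~~ F i -> c ord0 i = 0 &
         \sum_i c ord0 i = 1] & x = c *m S].

Definition simplex (S : 'M[R]_(d.+1, d)) : set 'rV[R]_d := hull_of S predT.

Definition diam (S : 'M[R]_(d.+1, d)) : R :=
  \big[Num.max/0]_i \big[Num.max/0]_j enorm (row i S - row j S).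

Definition common_vertex (S S' : 'M[R]_(d.+1, d)) : pred 'I_d.+1 :=
  fun i => [exists j, row i S == row j S'].

Definition covered (p : nat) (K : 'I_p -> 'M[R]_(d.+1, d)) : set 'rV[R]_d :=
  [set x | exists k, simplex (K k) x].

(* Conforming, quasi-uniform partition of Omega into simplices, of mesh size h;
   kappa is the quasi-uniformity constant (it bounds from below both the ratio
   of the diameters and the inradii).  If d = 1 the elements cover closure Omega
   exactly.  If d = 2, Omega has a smooth boundary and is not a polygon: the
   triangles lie in closure Omega (so that V_h is included in H^1_0(Omega)) and
   cover Omega up to a strip of width h along the boundary. *)
Definition quasi_uniform_partition (Omega : set 'rV[R]_d) (h kappa : R)
    (p : nat) (K : 'I_p -> 'M[R]_(d.+1, d)) : Prop :=
  [/\ [/\ 0 < h, h = \big[Num.max/0]_k diam (K k), 0 < kappa &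
          forall k, exists y,
            [set x | enorm (x - y) <= kappa * h] `<=` simplex (K k)],
      forall k l, k != l ->
        interior (simplex (K k)) `&` interior (simplex (K l)) = set0,
      forall k l, simplex (K k) `&` simplex (K l) `<=`
        hull_of (K k) (common_vertex (K k) (K l)),
      covered K `<=` closure Omega &
      if d == 1%N then closure Omega `<=` covered K else
      forall x, Omega x -> ~ covered K x ->
        exists2 y, bdry Omega y & enorm (x - y) <= h].

(* V_h: continuous, piecewise linear, extended by 0 outside the elements, hence
   vanishing on the boundary of Omega. *)
Definition Vh (p : nat) (K : 'I_p -> 'M[R]_(d.+1, d)) : set ('rV[R]_d -> R) :=
  [set v | [/\ continuous v, forall x, ~ covered K x -> v x = 0 &
    forall k, exists (q : 'rV[R]_d) (c : R), forall x, simplex (K k) x ->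
      v x = \sum_(i < d) q ord0 i * x ord0 i + c]].

End finite_elements.

Section time.
Context (R : realType).
Implicit Types (t sigma alpha mu : nat -> R) (n j s m : nat) (al : R).

Definition Gamma (z : R) : R :=
  \int[@lebesgue_measure R]_(x in `]0, +oo[%classic) (x `^ (z - 1) * expR (- x)).

Definition graded_mesh (T r : R) (N : nat) : nat -> R :=
  fun n => T * (n%:R / N%:R) `^ r.

Definition tau t n : R := t n - t n.-1.

(* [t] is the sequence of the t_n; the orders alpha s and the weights mu s are
   indexed by 1 <= s <= m. *)
Definition Gfun m alpha mu t n (x : R) : R :=
  \sum_(1 <= s < m.+1) mu s / Gamma (3 - alpha s) * x `^ (1 - alpha s) *
    (x - (1 - alpha s / 2)) * tau t n `^ (2 - alpha s).

(* A root is unique, G_n being increasing on this interval. *)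
Definition is_sigma_star m alpha mu t n (x : R) : Prop :=
  1 - alpha 1%N / 2 <= x <= 1 - alpha m / 2 /\ Gfun m alpha mu t n x = 0.

Definition tshift t sigma n : R := (1 - sigma n) * t n + sigma n * t n.-1.

Definition coef_a al t sigma n j : R :=
  (Gamma (1 - al))^-1 *
  \int[@lebesgue_measure R]_(eta in
      `[t j.-1, (if j == n then tshift t sigma n else t j)]%classic)
    (tshift t sigma n - eta) `^ (- al).

Definition coef_b al t sigma n j : R :=
  2 / (Gamma (1 - al) * (t j.+1 - t j.-1)) *
  \int[@lebesgue_measure R]_(eta in `[t j.-1, t j]%classic)
    ((tshift t sigma n - eta) `^ (- al) * (eta - (t j.-1 + t j) / 2)).

Definition coef_g_al al t sigma n j : R :=
  (tau t j)^-1 *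
  (coef_a al t sigma n j + (if (1 < j)%N then coef_b al t sigma n j.-1 else 0)
   - (if (j < n)%N then coef_b al t sigma n j else 0)).

Definition coef_g m alpha mu t sigma n j : R :=
  \sum_(1 <= s < m.+1) mu s * coef_g_al (alpha s) t sigma n j.

Definition Dfrac (X : Type) m alpha mu t sigma (v : nat -> X -> R) n : X -> R :=
  fun x => \sum_(1 <= j < n.+1)
    coef_g m alpha mu t sigma n j * (v j x - v j.-1 x).

Definition wavg (X : Type) sigma (v : nat -> X -> R) n : X -> R :=
  fun x => (1 - sigma n) * v n x + sigma n * v n.-1 x.

(* \hat v^{n - sigma_n}; only meaningful for n >= 2 *)
Definition extrap (X : Type) t sigma (v : nat -> X -> R) n : X -> R :=
  fun x => (tau t n.-1 + (1 - sigma n) * tau t n) / tau t n.-1 * v n.-1 x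
           - (1 - sigma n) * tau t n / tau t n.-1 * v n.-2 x.

End time.

Section scheme.
Context (R : realType) (d : nat).

Definition int_Omega (Omega : set 'rV[R]_d) (w : 'rV[R]_d -> R) : R :=
  \int[lebesgue_rV d]_(x in Omega) w x.

Definition fully_discrete_solution (Omega : set 'rV[R]_d)
    (V : set ('rV[R]_d -> R)) (a : R -> R) (f : R -> 'rV[R]_d -> R)
    (m : nat) (alpha mu : nat -> R) (N : nat) (t sigma : nat -> R)
    (uh0 : 'rV[R]_d -> R) (U : nat -> 'rV[R]_d -> R) : Prop :=
  [/\ V uh0, U 0%N = uh0, forall n, (1 <= n <= N)%N -> V (U n),
      forall v, V v ->
        dotL2 Omega (Dfrac m alpha mu t sigma U 1%N) v
        + a (int_Omega Omega (wavg sigma U 1%N)) * dot_grad Omega (wavg sigma U 1%N) v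
        = dotL2 Omega (f (tshift t sigma 1%N)) v &
      forall n, (2 <= n <= N)%N -> forall v, V v ->
        dotL2 Omega (Dfrac m alpha mu t sigma U n) v
        + a (int_Omega Omega (extrap t sigma U n)) * dot_grad Omega (wavg sigma U n) v
        = dotL2 Omega (f (tshift t sigma n)) v].

End scheme.

(* Main.v *)
Require Import Defs.
From mathcomp Require Import all_boot all_order all_algebra.
From mathcomp Require Import all_classical all_reals all_analysis.
From mathcomp Require Import measurable_realfun ring lra.

Import Order.TTheory GRing.Theory Num.Theory.
Import numFieldNormedType.Exports.

Local Open Scope classical_set_scope.
Local Open Scope ring_scope.

(** Fix a time level n, and write q for the shifted node t_{n-sigma_n}, th for
sigma_n^star and
  k(x) = sum_s mu_s / Gamma(1 - alpha_s) (q - x)^(-alpha_s),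
a positive, increasing and convex function of x < q.

The convolution weights g_{n,j} turn out to be squeezed between values of k:
k(t_{j-1}) <= g_{n,j} <= k(t_j) for j < n ([coef_g_ge], [coef_g_le]).  Hence
they increase with j, and g_{n,1} is at least
c = sum_s mu_s / Gamma(1 - alpha_s) T^(-alpha_s), a constant that knows neither
the mesh nor its grading.  For the last weight, the equation G_n(th) = 0 says
that k has zero first moment about the midpoint of the n-th cell over
(t_{n-1}, q); it gives th^2 k(t_{n-1}) <= (2 th - 1) g_{n,n}
([coef_g_diag_ge]), and so th^2 g_{n,n-1} <= (2 th - 1) g_{n,n}.

Let B be a symmetric nonnegative bilinear form, w = th U^n + (1 - th) U^{n-1}
and e_j = B(w - U^j, w - U^j).  Then
  2 B(D_N U, w) - sum_j g_{n,j} (B(U^j, U^j) - B(U^{j-1}, U^{j-1}))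
    = sum_j g_{n,j} (e_{j-1} - e_j).
After summation by parts the only negative term is -g_{n,n} e_n, to be set
against (g_{n,n} - g_{n,n-1}) e_{n-1}.  As e_n = (1 - th)^2 B(d, d) and
e_{n-1} = th^2 B(d, d) with d = U^n - U^{n-1}, the inequality on the last two
weights is exactly what makes the balance nonnegative ([energy_estimate]).  On the other hand, D_N z <= Q at every level forces
z_n <= z_0 + Q / c, since the weights increase and the first one is at least c
([discrete_max_principle]); this takes the place of a fractional Gronwall
inequality.

For the L^2 bound, test the scheme with w: the diffusion term is nonnegative,
and (f, w) is absorbed by Young's inequality, half of the maximum of the
||U^k||^2 being moved to the left ([energy_bound_source]).  For the gradient
bound, test with D_N U, which belongs to V_h:
  ||D_N U||^2 + a (grad w, grad D_N U) = (f, D_N U) <= ||D_N U||^2 + ||f||^2 / 4,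
so that 2 (grad w, grad D_N U) <= M^2 / (2 m1), whatever the value a >= m1
([energy_bound]).

It remains to know that (u, v) and (grad u, grad v) are bilinear on V_h.  For
the latter the classical partial derivatives are only additive where they
exist; they do off the hyperplanes supporting the faces of the elements, a null set
([skeleton_null], [Vh_dot_grad_semi_inner_product]). *)

(** * The Gamma function and integrals of singular powers *)

(** The integrand may blow up at both ends, so the fundamental theorem is applied
on [a + e_k, b - e_k] and e_k is sent to 0 by monotone convergence. *)
Lemma improper_FTC (R : realType) (f F : R -> R) (a b : R) : a < b ->
  (forall x, a < x < b -> 0 <= f x) ->
  (forall x, a < x < b -> {for x, continuous f}) ->
  (forall x, a < x < b -> is_derive x 1 F (f x)) ->
  F x @[x --> a^'+] --> F a -> F x @[x --> b^'-] --> F b ->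
  (\int[@lebesgue_measure R]_(x in `]a, b[%classic) (f x)%:E = (F b - F a)%:E)%E.
Proof.
move=> ab f0 cf dF Fa Fb.
(* Dividing by at least 3 keeps the shrunken interval nondegenerate. *)
pose e (k : nat) : R := (b - a) / (k.+3)%:R.
have ba0 : 0 < b - a by rewrite subr_gt0.
have e0 k : 0 < e k by rewrite divr_gt0.
have elt k : e k * 2 < b - a.
  by rewrite /e -mulrA gtr_pMr// mulrC ltr_pdivrMr// mul1r ltr_nat.
have ecvg : e k @[k --> \oo] --> (0 : R).
  rewrite -[X in _ --> X](mulr0 (b - a)); apply: cvgM; first exact: cvg_cst.
  have := @cvg_harmonic R; rewrite -(cvg_shiftn 2) => H.
  by apply: cvg_trans H; apply: near_eq_cvg; near=> k; rewrite /harmonic /= addn2.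
pose S (k : nat) : set R := `[a + e k, b - e k]%classic.
have Sin k x : S k x -> a < x < b.
  rewrite /S /= in_itv /= => /andP[h1 h2]; have := e0 k; lra.
have -> : `]a, b[%classic = \bigcup_k S k.
  apply/seteqP; split => [x|x [k _]]; last by move/Sin; rewrite /= in_itv.
  rewrite /= in_itv /= => /andP[ax xb].
  have d0 : 0 < Num.min (x - a) (b - x) by rewrite lt_min !subr_gt0 ax xb.
  move/cvgrPdist_lt : ecvg => /(_ _ d0) [k _ /(_ k (leqnn k))].
  rewrite sub0r normrN gtr0_norm // lt_min => /andP[h1 h2].
  by exists k => //; rewrite /S /= in_itv /=; lra.
have ndS : nondecreasing_seq S.
  move=> i j ij; apply/subsetPset => x; rewrite /S /= !in_itv /=.
  have : e j <= e i by rewrite /e ler_pM2l // lef_pV2 ?posrE // ler_nat !ltnS.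
  lra.
have cS k : {within S k, continuous f}.
  apply: continuous_in_subspaceT => x; rewrite inE => /Sin; exact: cf.
have mS k : measurable (S k : set (measurableTypeR R)) by exact: measurable_itv.
apply: (cvg_unique (@ereal_hausdorff R) (F := (\int[@lebesgue_measure R]_(x in S i) (f x)%:E)%E @[i --> \oo])) => //.
  apply: ge0_nondecreasing_set_cvg_integral => //.
    by move=> k; apply/measurable_EFinP; apply: subspace_continuous_measurable_fun; [exact: mS|exact: cS].
  by move=> k x /Sin /f0; rewrite lee_fin.
have IE k : (\int[@lebesgue_measure R]_(x in S k) (f x)%:E =
    (F (b - e k) - F (a + e k))%:E)%E.
  rewrite EFinB; apply: continuous_FTC2 => //.
  - have := elt k; lra.
  - exact: cS.
  - have dk x : a < x < b -> derivable F x 1 by move=> h; have ? := dF x h; exact: ex_derive.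
    have ck x : a < x < b -> {for x, continuous F}.
      by move=> /dk /derivable1_diffP; exact: differentiable_continuous.
    have := elt k; have := e0 k => h1 h2.
    split.
    + by move=> x; rewrite in_itv /= => h; apply: dk; lra.
    + by apply: cvg_at_right_filter; apply: ck; lra.
    + by apply: cvg_at_left_filter; apply: ck; lra.
  - move=> x /= xk; rewrite derive1E.
    have xab : a < x < b.
      by apply: (Sin k); rewrite /S /=; exact: subset_itv_oo_cc.
    by have ? := dF x xab; rewrite derive_val.
rewrite (_ : (fun _ => _) = fun k => (F (b - e k) - F (a + e k))%:E); last exact/funext.
apply: cvg_EFin; first by near=> k.
apply: cvgB.
  apply: (cvg_at_leftP F b (F b)).1 => //; split; first by move=> k; have := e0 k; lra.
  by rewrite -[X in _ --> X]subr0; apply: cvgB => //; exact: cvg_cst.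
apply: (cvg_at_rightP F a (F a)).1 => //; split; first by move=> k; have := e0 k; lra.
by rewrite -[X in _ --> X]addr0; apply: cvgD => //; exact: cvg_cst.
Unshelve. all: by end_near. Qed.

Lemma integral_singular_powR (R : realType) (z p q : R) : 0 < z -> p < q ->
  (\int[@lebesgue_measure R]_(x in `]p, q[%classic) ((q - x) `^ (z - 1))%:E
   = ((q - p) `^ z / z)%:E)%E.
Proof.
move=> z0 pq.
have dq x : x < q -> is_derive x 1 (fun x => - ((q - x) `^ z / z)) ((q - x) `^ (z - 1)).
  move=> xq; have qx : 0 < q - x by rewrite subr_gt0.
  have ? : is_derive (q - x) 1 (@powR R ^~ z) (z * (q - x) `^ (z - 1)) by exact: is_derive1_powR.
  have ? : is_derive x 1 (fun x => q - x) (-1 : R).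
    by apply: is_derive_eq; ring.
  have ? : is_derive x 1 (fun x => (q - x) `^ z) (- (z * (q - x) `^ (z - 1))).
    apply: (is_derive_eq (f' := z * (q - x) `^ (z - 1) * -1)); last by ring.
    exact: (@is_derive1_comp R (@powR R ^~ z) (fun x => q - x)).
  apply: is_derive_eq.
  by rewrite /GRing.scale /= ; field; lra.
transitivity (- ((q - q) `^ z / z) - - ((q - p) `^ z / z))%:E; last first.
- by congr EFin; rewrite subrr powR0 ?gt_eqF // mul0r oppr0 sub0r opprK.
apply: (@improper_FTC R _ (fun x => - ((q - x) `^ z / z))) => //.
- by move=> x _; exact: powR_ge0.
- move=> x /andP[_ xq].
  apply: (@continuous_comp _ _ _ (fun x => q - x) (@powR R ^~ (z - 1))).
    by apply: continuousB; [exact: cst_continuous|exact: cvg_id].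
  apply/differentiable_continuous/derivable1_diffP.
  by apply: derivable_powR; rewrite in_itv /= andbT subr_gt0.
- by move=> x /andP[_ xq]; exact: dq.
- apply: cvg_at_right_filter.
  have /derivable1_diffP /differentiable_continuous :
      derivable (fun x => - ((q - x) `^ z / z)) p 1.
    by have ? := dq p pq; exact: ex_derive.
  by apply.
- rewrite subrr powR0 ?gt_eqF // mul0r; apply: cvgN.
  rewrite -(mul0r z^-1); apply: cvgM; last exact: cvg_cst.
  apply/cvg_at_leftP => u [uq ucvg].
  have := (cvg_at_rightP (@powR R ^~ z) 0 0).1 (powR_cvg0 z0) (fun n => q - u n).
  apply; split => [n|]; first by rewrite subr_gt0.
  by rewrite -[X in _ --> X](subrr q); apply: cvgB => //; exact: cvg_cst.
Qed.

Lemma integral_powR (R : realType) (z q : R) : 0 < z -> 0 < q ->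
  (\int[@lebesgue_measure R]_(x in `]0%R, q[%classic) (x `^ (z - 1))%:E
   = (q `^ z / z)%:E)%E.
Proof.
move=> z0 q0.
have dq (x : R) : 0 < x -> is_derive x 1 (fun x => x `^ z / z) (x `^ (z - 1)).
  move=> x0.
  have ? : is_derive x 1 (fun x => x `^ z) (z * x `^ (z - 1)) by exact: is_derive1_powR.
  apply: is_derive_eq.
  by rewrite /GRing.scale /= ; field; lra.
transitivity (q `^ z / z - 0 `^ z / z)%:E; last first.
  by congr EFin; rewrite powR0 ?gt_eqF // mul0r subr0.
apply: (@improper_FTC R _ (fun x => x `^ z / z)) => //.
- by move=> x _; exact: powR_ge0.
- move=> x /andP[x0 _].
  apply/differentiable_continuous/derivable1_diffP.
  by apply: derivable_powR; rewrite in_itv /= andbT.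
- by move=> x /andP[x0 _]; exact: dq.
- apply: cvgM; last exact: cvg_cst.
  by rewrite powR0 ?gt_eqF //; exact: powR_cvg0.
- apply: cvg_at_left_filter.
  have /derivable1_diffP /differentiable_continuous :
      derivable (fun x => x `^ z / z) q 1.
    by have ? := dq q q0; exact: ex_derive.
  by apply.
Qed.

(** The integral defining Gamma before its projection to the reals, which sends
an infinite value to 0; finiteness is [Gammae_lty]. *)
Definition Gammae (R : realType) (z : R) : \bar R :=
  (\int[@lebesgue_measure R]_(x in `]0%R, +oo[%classic)
    (x `^ (z - 1) * expR (- x))%:E)%E.

Lemma integral_expRN_gt (R : realType) (y : R) :
  (\int[@lebesgue_measure R]_(x in `]y, +oo[%classic) (expR (- x))%:E
   = (expR (- y))%:E)%E.
Proof.
have cexp : continuous (fun x : R => expR (- x)).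
  move=> x; apply: (@continuous_comp _ _ _ -%R expR); last exact: continuous_expR.
  exact: continuousN.
rewrite integral_itv_obnd_cbnd; last first.
  by apply/measurable_EFinP/measurable_funTS; exact: continuous_measurable_fun.
rewrite (@ge0_continuous_FTC2y _ _ (fun x => - expR (- x)) _ 0) //.
- by rewrite sub0e -EFinN opprK.
- exact: continuous_subspaceT.
- by rewrite -oppr0; apply: cvgN; exact: cvgr_expR.
- by apply: cvg_at_right_filter; apply: cvgN; exact: cexp.
- move=> x _; rewrite derive1E derive_val.
  by rewrite /GRing.scale /=; ring.
Qed.

(** Instead of integrating by parts, x^z is written as the integral of
z y^(z-1) over 0 < y < x and the order of integration is exchanged. Both sides
are nonnegative, so nothing has to be known about convergence. *)
Lemma Gammae_rec (R : realType) (z : R) : 0 < z ->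
  (Gammae _ (z + 1) = z%:E * Gammae _ z)%E.
Proof.
move=> z0.
pose mu := @lebesgue_measure R.
pose h (p : measurableTypeR R * measurableTypeR R) : \bar R :=
  (if (0 < p.2) && (p.2 < p.1) then z * p.2 `^ (z - 1) * expR (- p.1) else 0)%:E.
have mh : measurable_fun setT h.
  apply/measurable_EFinP; apply: measurable_fun_ifT => //.
    apply: measurable_and.
      by apply: measurable_fun_ltr => //; exact: measurable_snd.
    by apply: measurable_fun_ltr => //.
  apply: measurable_funM.
    apply: measurable_funM => //.
    by apply: (measurableT_comp (measurable_powR _)); exact: measurable_snd.
  apply: (measurableT_comp (@measurable_expR R)).
  by apply: measurable_funN; exact: measurable_fst.
have h0 p : (0 <= h p)%E.
  rewrite /h lee_fin; case: ifP => // _.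
  by rewrite mulr_ge0 ?expR_ge0 // mulr_ge0 ?powR_ge0 // ltW.
have := @fubini_tonelli _ _ _ _ R mu mu h mh h0.
have inner1 x : (\int[mu]_y h (x, y) =
    if (0 < x)%R then (x `^ z * expR (- x))%:E else 0)%E.
  case: ifPn => x0; last first.
    apply: integral0_eq => y _; rewrite /h /=; case: ifP => // /andP[y0 yx].
    by rewrite (lt_trans y0 yx) in x0.
  transitivity (\int[mu]_(y in `]0%R, x[%classic)
     ((z * expR (- x))%:E * (y `^ (z - 1))%:E))%E.
    rewrite [RHS]integral_mkcond; apply: eq_integral => y _.
    rewrite /h /= patchE mem_setE in_itv /=; case: ifP => // _.
    by rewrite -EFinM; congr EFin; ring.
  rewrite ge0_integralZl //.
  - by rewrite integral_powR // -EFinM; congr EFin; field; rewrite gt_eqF.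
  - by apply/measurable_EFinP/measurable_funTS; exact: measurable_powR.
  - by move=> y _; rewrite lee_fin powR_ge0.
  - by rewrite lee_fin mulr_ge0 ?expR_ge0 // ltW.
have inner2 y : (\int[mu]_x h (x, y) =
    if (0 < y)%R then z%:E * (y `^ (z - 1) * expR (- y))%:E else 0)%E.
  case: ifPn => y0; last first.
    by apply: integral0_eq => x _; rewrite /h /= (negbTE y0).
  transitivity (\int[mu]_(x in `]y, +oo[%classic)
     ((z * y `^ (z - 1))%:E * (expR (- x))%:E))%E.
    rewrite [RHS]integral_mkcond; apply: eq_integral => x _.
    by rewrite /h /= patchE mem_setE in_itv /= andbT y0 /=; case: ifP.
  rewrite ge0_integralZl //.
  - by rewrite integral_expRN_gt -!EFinM mulrA.
  - apply/measurable_EFinP/measurable_funTS.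
    by apply: (measurableT_comp (@measurable_expR R)); exact: measurable_funN.
  - by rewrite lee_fin mulr_ge0 ?powR_ge0 // ltW.
under eq_integral do rewrite inner1.
under [in RHS]eq_integral do rewrite inner2.
move=> H.
transitivity (\int[mu]_x (if (0 < x)%R then (x `^ z * expR (- x))%:E else 0%E))%E.
  rewrite /Gammae integral_mkcond; apply: eq_integral => x _.
  by rewrite patchE mem_setE in_itv /= andbT addrK.
rewrite H -ge0_integralZl //.
- rewrite [RHS]integral_mkcond; apply: eq_integral => x _.
  by rewrite patchE mem_setE in_itv /= andbT.
- apply/measurable_EFinP/measurable_funTS/measurable_funM; first exact: measurable_powR.
  by apply: (measurableT_comp (@measurable_expR R)); exact: measurable_funN.
- by move=> x _; rewrite lee_fin mulr_ge0 ?expR_ge0 ?powR_ge0.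
- by rewrite lee_fin ltW.
Qed.

(** By [Gammae_rec] it is enough to treat z + 1, where the integrand is no longer
singular at 0 and x^z <= 1 + x <= 2 exp(x/2). *)
Lemma Gammae_lty (R : realType) (z : R) : 0 < z <= 1 -> (Gammae _ z < +oo)%E.
Proof.
move=> /andP[z0 z1].
suff : (Gammae _ (z + 1) < +oo)%E.
  rewrite Gammae_rec // => H; rewrite ltNge; apply/negP => /=.
  by rewrite leye_eq => /eqP E; move: H; rewrite E gt0_muley // ltxx.
have cexp : continuous (fun x : R => 2 * expR (- (2^-1 * x))).
  move=> x; have /derivable1_diffP /differentiable_continuous :
    derivable (fun x : R => 2 * expR (- (2^-1 * x))) x 1 by exact: ex_derive.
  by apply.
apply: (@le_lt_trans _ _ (\int[@lebesgue_measure R]_(x in `[0%R, +oo[%classic)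
    (2 * expR (- (2^-1 * x)))%:E)%E).
  rewrite -integral_itv_obnd_cbnd; last first.
    by apply/measurable_EFinP/measurable_funTS; exact: continuous_measurable_fun.
  apply: ge0_le_integral => //.
  - by move=> x _; rewrite lee_fin mulr_ge0 ?expR_ge0 ?powR_ge0.
  - apply/measurable_EFinP/measurable_funTS/measurable_funM; first exact: measurable_powR.
    by apply: (measurableT_comp (@measurable_expR R)); exact: measurable_funN.
  - by apply/measurable_EFinP/measurable_funTS; exact: continuous_measurable_fun.
  - move=> x /=; rewrite in_itv /= andbT addrK => x0; rewrite lee_fin.
    have xz : x `^ z <= 2 * expR (2^-1 * x).
      have := expR_ge1Dx (2^-1 * x).
      have [x1|x1] := leP x 1.
        have : x `^ z <= 1.
          have : x `^ z <= 1 `^ z by apply: ge0_ler_powR; rewrite ?nnegrE // ltW.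
          by rewrite powR1.
        lra.
      by have := ler1_powR (ltW x1) z1; lra.
    have -> : - x = - (2^-1 * x) - 2^-1 * x by field.
    rewrite expRD mulrA ler_pM2r ?expR_gt0 //.
    rewrite expRN ler_pdivrMr ?expR_gt0 //.
rewrite (@ge0_continuous_FTC2y _ _ (fun x => - 4 * expR (- (2^-1 * x))) _ 0) //.
- by rewrite ltry.
- exact: continuous_subspaceT.
- rewrite -(mulr0 (-4)); apply: cvgM; first exact: cvg_cst.
  apply: (@cvg_comp _ _ _ (fun x => 2^-1 * x) (fun x => expR (- x)) _ (pinfty_nbhs R)).
    by apply: gt0_cvgMry; rewrite ?invr_gt0.
  exact: cvgr_expR.
- apply: cvg_at_right_filter.
  have /derivable1_diffP /differentiable_continuous :
    derivable (fun x : R => - 4 * expR (- (2^-1 * x))) 0 1 by exact: ex_derive.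
  by apply.
- move=> x _; rewrite derive1E derive_val.
  by rewrite /GRing.scale /=; field.
Qed.

Lemma Gammae_gt0 (R : realType) (z : R) : 0 < z <= 1 -> (0 < Gammae _ z)%E.
Proof.
move=> /andP[z0 z1].
have mf (D : set R) : measurable_fun D (fun x : R => (x `^ (z - 1) * expR (- x))%:E).
  apply/measurable_EFinP/measurable_funTS/measurable_funM; first exact: measurable_powR.
  by apply: (measurableT_comp (@measurable_expR R)); exact: measurable_funN.
have f0 x : (0 <= (x `^ (z - 1) * expR (- x))%:E)%E.
  by rewrite lee_fin mulr_ge0 ?expR_ge0 ?powR_ge0.
apply: (@lt_le_trans _ _ (\int[@lebesgue_measure R]_(x in `]0%R, 1%R[%classic)
    (expR (- 1))%:E)%E).
  rewrite integral_cst //= lebesgue_measure_itv /= lte_fin ltr01 -EFinB -EFinM.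
  by rewrite lte_fin subr0 mulr1 expR_gt0.
apply: (@le_trans _ _ (\int[@lebesgue_measure R]_(x in `]0%R, 1%R[%classic)
    (x `^ (z - 1) * expR (- x))%:E)%E).
  apply: ge0_le_integral => //.
  - exact: mf.
  - move=> x /=; rewrite in_itv /= => /andP[x0 x1].
    rewrite lee_fin -[leLHS]mul1r ler_pM ?expR_ge0 ?ler_expR //; last by rewrite lerN2 ltW.
    rewrite -[leLHS](powRr0 x); apply: ger_powR; first by rewrite x0 ltW.
    by rewrite subr_le0.
apply: ge0_subset_integral => //; first exact: mf.
by move=> x /=; rewrite !in_itv /= andbT => /andP[].
Qed.

Lemma Gamma_gt0 (R : realType) (z : R) : 0 < z <= 1 -> 0 < Gamma z.
Proof.
by move=> z01; rewrite fine_gt0 // Gammae_gt0 // Gammae_lty.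
Qed.

Lemma Gamma_rec (R : realType) (z : R) : 0 < z -> Gamma (z + 1) = z * Gamma z.
Proof.
move=> z0; have -> : Gamma (z + 1) = fine (Gammae R (z + 1)) by [].
rewrite Gammae_rec // /Gamma /Rintegral -/(Gammae R z).
have [->|zoo] := eqVneq (Gammae R z) +oo%E.
  by rewrite gt0_muley ?lte_fin //= mulr0.
rewrite fineM // ge0_fin_numE ?ltey //.
by apply: integral_ge0 => x _; rewrite lee_fin mulr_ge0 ?expR_ge0 ?powR_ge0.
Qed.

(** Relates the normalization of the equation for the shift to that of the
weights. *)
Lemma Gamma_3B (R : realType) (al : R) : 0 < al < 1 ->
  Gamma (3 - al) = (2 - al) * (1 - al) * Gamma (1 - al).
Proof.
move=> /andP[a0 a1].
have -> : 3 - al = 2 - al + 1 by ring.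
rewrite Gamma_rec; last by lra.
have -> : 2 - al = 1 - al + 1 by ring.
by rewrite Gamma_rec ?mulrA //; lra.
Qed.

(** * Moments of a monotone function on an interval *)

Lemma integrable_itvcc (R : realType) (f : R -> R) (p q : R) :
  {within `[p, q], continuous f} ->
  (@lebesgue_measure R).-integrable `[p, q] (EFin \o f).
Proof.
by move=> cf; apply: continuous_compact_integrable => //; exact: segment_compact.
Qed.

Lemma Rintegral_affine (R : realType) (p q u v : R) : p < q ->
  \int[@lebesgue_measure R]_(x in `[p, q]) (u + v * (x - (p + q) / 2)) = u * (q - p).
Proof.
move=> pq.
pose F (x : R) : R := u * x + v / 2 * (x - (p + q) / 2) ^+ 2.
have dF (x : R) : is_derive x 1 F (u + v * (x - (p + q) / 2)).
  by apply: is_derive_eq; rewrite /GRing.scale /=; field.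
have cF : continuous F.
  move=> x; have ? := dF x.
  by apply/differentiable_continuous/derivable1_diffP; exact: ex_derive.
have cf : continuous (fun x : R => u + v * (x - (p + q) / 2)).
  move=> x; have /derivable1_diffP /differentiable_continuous :
    derivable (fun x : R => u + v * (x - (p + q) / 2)) x 1 by exact: ex_derive.
  by apply.
rewrite /Rintegral (@continuous_FTC2 _ _ F) //=.
- by rewrite /F; field.
- by move=> x; exact: continuous_subspaceT.
- split.
  + by move=> x _; have ? := dF x; exact: ex_derive.
  + by apply: cvg_at_right_filter; exact: cF.
  + by apply: cvg_at_left_filter; exact: cF.
- by move=> x _; rewrite derive1E; have ? := dF x; rewrite derive_val.
Qed.

Lemma within_continuous_affine (R : realType) (D : set R) (u v c : R) :
  {within D, continuous (fun x => u + v * (x - c))}.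
Proof.
apply: continuous_subspaceT => x.
have /derivable1_diffP /differentiable_continuous :
  derivable (fun x : R => u + v * (x - c)) x 1 by exact: ex_derive.
by apply.
Qed.

Lemma within_continuous_mul_affine (R : realType) (k : R -> R) (u v p q c : R) :
  {within `[p, q], continuous k} ->
  {within `[p, q], continuous (fun x => k x * (u + v * (x - c)))}.
Proof.
move=> ck x; apply: (@cvgM R _ _ _ k).
- exact: nbhs_subspace_filter.
- exact: ck.
- exact: within_continuous_affine.
Qed.

Section one_interval.
Context (R : realType) (k : R -> R) (p q : R).
Context (pq : p < q) (ck : {within `[p, q], continuous k}).
Let I (f : R -> R) := \int[@lebesgue_measure R]_(x in `[p, q]) f x.
Let mid := (p + q) / 2.

Let le_I (f g : R -> R) : {within `[p, q], continuous f} ->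
  {within `[p, q], continuous g} -> (forall x, p <= x <= q -> f x <= g x) ->
  I f <= I g.
Proof.
move=> cf cg fg; apply: le_Rintegral => //; exact: integrable_itvcc.
Qed.

Let c1 (u v : R) : {within `[p, q], continuous (fun x => u + v * (x - mid))}.
Proof. exact: within_continuous_affine. Qed.

Lemma Rintegral_weight (u v : R) :
  I (fun x => k x * (u + v * (x - mid))) = u * I k + v * I (fun x => k x * (x - mid)).
Proof.
have i1 := integrable_itvcc _ _ _ _ ck.
have c2 : {within `[p, q], continuous (fun x => k x * (x - mid))}.
  have -> : (fun x => k x * (x - mid)) = (fun x => k x * (0 + 1 * (x - mid))).
    by apply/funext => x; rewrite add0r mul1r.
  exact: within_continuous_mul_affine.
rewrite -!RintegralZl //; last exact: integrable_itvcc.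
rewrite -RintegralD //.
- by apply: eq_Rintegral => x _; ring.
- exact: (@integrableZl _ _ R _ _ _ u _ i1).
- exact: (@integrableZl _ _ R _ _ _ v _ (integrable_itvcc _ _ _ _ c2)).
Qed.

Context (kmono : forall x y, p <= x <= y -> y <= q -> k x <= k y).

(** Subtracting the constant k(mid), which has zero moment, leaves a product of
two factors of the same sign. *)
Lemma first_moment_ge0 : 0 <= I (fun x => k x * (x - mid)).
Proof.
have -> : 0 = I (fun x => 0 + k mid * (x - mid)) by rewrite /I Rintegral_affine // mul0r.
have -> : I (fun x => k x * (x - mid)) = I (fun x => k x * (0 + 1 * (x - mid))).
  by apply: eq_Rintegral => x _; rewrite add0r mul1r.
apply: le_I; [exact: c1|exact: within_continuous_mul_affine|] => x xpq.
rewrite add0r mul1r add0r -subr_ge0 -mulrBl.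
have mp : p <= mid <= q by rewrite /mid; lra.
have [xm|xm] := leP x mid.
  have : k x <= k mid by apply: kmono; lra.
  by move=> ?; rewrite mulr_le0 // subr_le0.
have : k mid <= k x by apply: kmono; lra.
by move=> ?; rewrite mulr_ge0 // subr_ge0 // ltW.
Qed.

(** The left-hand integrand is k times the affine weight 1 - 2 (x - mid) / D. The
weight is nonnegative because D is at least the length, and its integral is
the length, so k can be replaced by its minimum k(p). *)
Lemma mean_sub_moment_ge (D : R) : q - p <= D ->
  k p * (q - p) <= I k - 2 / D * I (fun x => k x * (x - mid)).
Proof.
move=> pD; have D0 : 0 < D by apply: lt_le_trans pD; rewrite subr_gt0.
rewrite -[I k]mul1r -mulNr -Rintegral_weight -(@Rintegral_affine _ p q _ (- (2 / D) * k p)) //.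
have cc := c1 (k p) (- (2 / D) * k p).
apply: le_I => //; first exact: within_continuous_mul_affine.
move=> x xpq; rewrite -/mid.
have -> : k p + - (2 / D) * k p * (x - mid) = k p * (1 + - (2 / D) * (x - mid)) by ring.
apply: ler_wpM2r; last by apply: kmono; lra.
rewrite mulNr subr_ge0 mulrAC ler_pdivrMr // mul1r /mid; lra.
Qed.

(** The hypothesis puts k below the line of slope s through (q, k q). *)
Lemma mean_le_of_slope (s : R) :
  (forall x, p <= x <= q -> s * (q - x) <= k q - k x) ->
  I k <= (k q - s * ((q - p) / 2)) * (q - p).
Proof.
move=> ks; rewrite -(@Rintegral_affine _ p q _ s) //.
have cc := c1 (k q - s * ((q - p) / 2)) s.
apply: le_I => // x /ks; rewrite /mid; lra.
Qed.

(** After subtracting k(mid), the integrand is at most s (x - mid)^2, and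
(x - mid)^2 <= (q - p)^2 / 4. The optimal constant would be 12 in place of 4. *)
Lemma first_moment_le (s : R) : 0 <= s ->
  (forall x y, p <= x <= y -> y <= q -> k y - k x <= s * (y - x)) ->
  I (fun x => k x * (x - mid)) <= s * (q - p) ^+ 3 / 4.
Proof.
move=> s0 ks.
have -> : s * (q - p) ^+ 3 / 4 = I (fun x => s * (q - p) ^+ 2 / 4 + k mid * (x - mid)).
  by rewrite /I Rintegral_affine //; field.
have -> : I (fun x => k x * (x - mid)) = I (fun x => k x * (0 + 1 * (x - mid))).
  by apply: eq_Rintegral => x _; rewrite add0r mul1r.
apply: le_I; [exact: within_continuous_mul_affine|exact: c1|] => x xpq.
rewrite add0r mul1r -lerBlDr -mulrBl.
have mp : p <= mid <= q by rewrite /mid; lra.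
have -> : s * (q - p) ^+ 2 / 4 = s * ((q - p) ^+ 2 / 4) by ring.
apply: (@le_trans _ _ (s * (x - mid) ^+ 2)); last first.
  by apply: ler_wpM2l => //; rewrite /mid; nra.
rewrite expr2 mulrA.
have [xm|xm] := leP x mid.
  have := ks x mid; rewrite (andP xpq).1 xm (andP mp).2 => /(_ isT isT).
  nra.
have := ks mid x; rewrite (andP mp).1 (ltW xm) (andP xpq).2 => /(_ isT isT).
nra.
Qed.

End one_interval.

(** * The weights of one fractional order *)

Section singular_kernel.
Context (R : realType) (al Q : R) (al01 : 0 < al < 1).
Let k (x : R) := (Q - x) `^ (- al).

Let dk (x : R) : x < Q -> is_derive x 1 k (al * (Q - x) `^ (- al - 1)).
Proof.
move=> xQ; have Qx : 0 < Q - x by rewrite subr_gt0.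
have ? : is_derive (Q - x) 1 (@powR R ^~ (- al)) (- al * (Q - x) `^ (- al - 1)).
  exact: is_derive1_powR.
have ? : is_derive x 1 (fun x => Q - x) (-1 : R) by apply: is_derive_eq; ring.
apply: (is_derive_eq (f' := (- al) * (Q - x) `^ (- al - 1) * -1)); last by ring.
exact: (@is_derive1_comp R (@powR R ^~ (- al)) (fun x => Q - x)).
Qed.

Lemma kernel_continuous (p q : R) : q < Q -> {within `[p, q], continuous k}.
Proof.
move=> qQ; apply: continuous_in_subspaceT => x; rewrite inE /= in_itv /= => /andP[_ xq].
have ? := dk x (le_lt_trans xq qQ).
have /derivable1_diffP /differentiable_continuous : derivable k x 1 by exact: ex_derive.
by apply.
Qed.

Lemma kernel_mono (x y : R) : x <= y -> y < Q -> k x <= k y.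
Proof.
move=> xy yQ; rewrite /k !powRN lef_pV2 ?posrE ?powR_gt0 //; last 2 first.
- lra.
- lra.
by have := al01 => a01; apply: ge0_ler_powR; rewrite ?nnegrE; lra.
Qed.

Let s (x : R) := al * (Q - x) `^ (- al - 1).

Lemma kernel_slope_ge0 x : 0 <= s x.
Proof. by have := al01 => a01; rewrite mulr_ge0 ?powR_ge0 //; lra. Qed.

Let s_mono (x y : R) : x <= y -> y < Q -> s x <= s y.
Proof.
move=> xy yQ; apply: ler_wpM2l; first by have := al01; lra.
have -> : - al - 1 = - (al + 1) by ring.
rewrite !powRN lef_pV2 ?posrE ?powR_gt0 //; last 2 first.
- lra.
- lra.
by have := al01 => a01; apply: ge0_ler_powR; rewrite ?nnegrE; lra.
Qed.

Let kernel_MVT (x y : R) : x <= y -> y < Q ->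
  exists2 c, x <= c <= y & k y - k x = s c * (y - x).
Proof.
rewrite le_eqVlt => /predU1P[<- _|xy yQ].
  by exists x; rewrite ?lexx // !subrr mulr0.
have := @MVT R k s x y xy.
case.
- by move=> z; rewrite in_itv /= => /andP[_ zy]; apply: dk; exact: lt_trans yQ.
- exact: kernel_continuous.
- by move=> c; rewrite in_itv /= => /andP[xc cy] ->; exists c => //; rewrite !ltW.
Qed.

(** s p is the derivative at p: by convexity it bounds the chord slopes to the left
of p from above and, in [kernel_slope_ge], those to the right from below. *)
Lemma kernel_slope_le (p x y : R) : x <= y -> y <= p -> p < Q ->
  k y - k x <= s p * (y - x).
Proof.
move=> xy yp pQ; have [|c /andP[xc cy] ->] := kernel_MVT x y xy; first by lra.
by apply: ler_wpM2r; [lra|apply: s_mono => //; lra].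
Qed.

Lemma kernel_slope_ge (p x y : R) : p <= x -> x <= y -> y < Q ->
  s p * (y - x) <= k y - k x.
Proof.
move=> px xy yQ; have [//|c /andP[xc cy] ->] := kernel_MVT x y xy.
by apply: ler_wpM2r; [lra|apply: s_mono => //; lra].
Qed.

End singular_kernel.

Section coefficients.
Context (R : realType) (al : R) (t sigma : nat -> R) (n : nat).
Context (al01 : 0 < al < 1).
Context (t_lt : forall j, (j < n)%N -> t j < t j.+1).
Context (tau_le : forall j, (j.+1 < n)%N -> t j.+1 - t j <= t j.+2 - t j.+1).
Let Q := tshift t sigma n.
Context (Q_gt : t n.-1 < Q).
Let k (x : R) := (Q - x) `^ (- al).
Let G := (Gamma (1 - al))^-1.

Let G0 : 0 < G.
Proof. by rewrite invr_gt0 Gamma_gt0 //; have := al01; lra. Qed.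

Let t_mono i j : (i <= j)%N -> (j <= n)%N -> t i <= t j.
Proof.
move=> ij jn; elim: j ij jn => [|j IH]; first by rewrite leqn0 => /eqP ->.
rewrite leq_eqVlt => /predU1P[-> //|ij] jn.
by apply: (le_trans (IH ij (ltnW jn))); rewrite ltW // t_lt.
Qed.

Let t_ltQ i : (i < n)%N -> t i < Q.
Proof.
move=> i_n; apply: le_lt_trans Q_gt; apply: t_mono; last exact: leq_pred.
by case: (n) i_n.
Qed.

Let moment i := \int[@lebesgue_measure R]_(x in `[t i, t i.+1])
  (k x * (x - (t i + t i.+1) / 2)).

Let coef_bE i : coef_b al t sigma n i.+1 = G * (2 / (t i.+2 - t i) * moment i).
Proof. by rewrite /coef_b /= -/(moment i) invfM /G; ring. Qed.

Let coef_aE i : (i.+1 < n)%N -> coef_a al t sigma n i.+1 =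
  G * \int[@lebesgue_measure R]_(x in `[t i, t i.+1]) k x.
Proof. by move=> i_n; rewrite /coef_a ltn_eqF. Qed.

Let kc i : (i.+1 < n)%N -> {within `[t i, t i.+1], continuous k}.
Proof. by move=> i_n; apply: kernel_continuous => //; exact: t_ltQ. Qed.

Let km i : (i.+1 < n)%N -> forall x y, t i <= x <= y -> y <= t i.+1 -> k x <= k y.
Proof.
move=> i_n x y /andP[_ xy] yt; apply: kernel_mono => //.
by apply: le_lt_trans yt _; exact: t_ltQ.
Qed.

Lemma coef_b_ge0 i : (i.+1 < n)%N -> 0 <= coef_b al t sigma n i.+1.
Proof.
move=> i_n; rewrite coef_bE mulr_ge0 ?(ltW G0) // mulr_ge0 //.
  rewrite divr_ge0 // subr_ge0; apply: t_mono => //.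
  exact: leqW.
apply: first_moment_ge0; [exact/t_lt/ltnW|exact: kc|exact: km].
Qed.

(** Dropping b_{n,j-1} >= 0, what remains is the mean of the kernel over the j-th
cell minus its correction b_{n,j}. *)
Lemma coef_g_al_ge i : (i.+1 < n)%N -> G * k (t i) <= coef_g_al al t sigma n i.+1.
Proof.
move=> i_n; rewrite /coef_g_al /tau /= i_n coef_aE // coef_bE.
have ti := t_lt i (ltnW i_n); have ti1 := t_lt i.+1 i_n.
rewrite [X in _ <= X]mulrC ler_pdivlMr ?subr_gt0 //.
have := @mean_sub_moment_ge R k (t i) (t i.+1) ti (kc i i_n) (km i i_n) (t i.+2 - t i).
have -> : t i.+1 - t i <= t i.+2 - t i by lra.
rewrite -/(moment i) => /(_ isT) H.
have B0 : 0 <= (if (1 < i.+1)%N then coef_b al t sigma n i else 0).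
  by case: i i_n {ti ti1 H} => [//|i] i_n /=; apply: coef_b_ge0; exact: ltnW.
have := ler_wpM2l (ltW G0) H.
lra.
Qed.

(** Dropping -b_{n,j} <= 0, the mean of the kernel k over the j-th cell falls short
of k(t_j) by at least s tau_j / 2, s being the slope of k at t_{j-1}. The
correction b_{n,j-1} lives on the preceding cell, where the slopes are at most
s, and that cell is no longer than the j-th: it cannot fill the gap. *)
Lemma coef_g_al_le i : (i.+1 < n)%N -> coef_g_al al t sigma n i.+1 <= G * k (t i.+1).
Proof.
move=> i_n; rewrite /coef_g_al /tau /= i_n coef_aE //.
have ti := t_lt i (ltnW i_n); have ti1 := t_lt i.+1 i_n.
rewrite [X in X <= _]mulrC ler_pdivrMr ?subr_gt0 //.
have B0 := coef_b_ge0 i i_n.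
pose s := al * (Q - t i) `^ (- al - 1).
have s0 : 0 <= s by apply: kernel_slope_ge0.
have H : \int[@lebesgue_measure R]_(x in `[t i, t i.+1]) k x <=
    (k (t i.+1) - s * ((t i.+1 - t i) / 2)) * (t i.+1 - t i).
  apply: mean_le_of_slope => //; first exact: kc.
  by move=> x /andP[x1 x2]; apply: kernel_slope_ge => //; exact: t_ltQ.
have H' := ler_wpM2l (ltW G0) H.
suff B1 : (if (1 < i.+1)%N then coef_b al t sigma n i else 0) <=
    G * (s * ((t i.+1 - t i) ^+ 2 / 2)) by lra.
case: i i_n ti ti1 B0 @s s0 H H' => [|i] i_n ti ti1 B0 s s0 H H' /=.
  by rewrite mulr_ge0 ?(ltW G0) // mulr_ge0 // divr_ge0 // sqr_ge0.
rewrite coef_bE; apply: ler_wpM2l; first exact: ltW.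
have i_n' := ltnW i_n.
have M : moment i <= s * (t i.+1 - t i) ^+ 3 / 4.
  apply: first_moment_le => //; [exact: t_lt i (ltnW i_n')|exact: kc|].
  by move=> x y /andP[x1 xy] y1; apply: kernel_slope_le => //; exact: t_ltQ.
have tl := t_lt i (ltnW i_n'); have tt := tau_le i i_n'.
have D0 : 0 < t i.+2 - t i by rewrite subr_gt0 (lt_trans tl).
rewrite mulrAC ler_pdivrMr //.
apply: (@le_trans _ _ (s * ((t i.+1 - t i) ^+ 3 / 2))); first by lra.
rewrite -[leRHS]mulrA; apply: ler_wpM2l => //.
set u := t i.+1 - t i in tt *; have u0 : 0 < u by rewrite subr_gt0.
have -> : t i.+2 - t i = (t i.+2 - t i.+1) + u by rewrite /u; ring.
set v := t i.+2 - t i.+1 in tt *.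
have : u ^+ 2 * u <= v ^+ 2 * u by apply: ler_wpM2r; [exact: ltW|rewrite ler_sqr ?nnegrE; lra].
have : 0 <= v ^+ 2 * v by rewrite mulr_ge0 ?sqr_ge0 //; lra.
rewrite !exprSr !expr0; lra.
Qed.

End coefficients.

(** * The graded mesh and the multi-term weights *)

Lemma Rintegral_singular_kernel (R : realType) (al p q : R) : al < 1 -> p < q ->
  \int[@lebesgue_measure R]_(x in `[p, q]) (q - x) `^ (- al)
  = (q - p) `^ (1 - al) / (1 - al).
Proof.
move=> al1 pq.
have mf : measurable_fun [set: R] (fun x : R => ((q - x) `^ (- al))%:E).
  apply/measurable_EFinP; apply: (measurableT_comp (@measurable_powR R (- al))).
  exact: measurable_funB.
rewrite /Rintegral -integral_itv_bndo_bndc; last exact: measurable_funTS.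
rewrite -integral_itv_obnd_cbnd; last exact: measurable_funTS.
have z0 : 0 < 1 - al by rewrite subr_gt0.
have := @integral_singular_powR R (1 - al) p q z0 pq.
have -> : 1 - al - 1 = - al by ring.
by move=> ->.
Qed.

Lemma graded_mesh_lt (R : realType) (T r : R) (N j : nat) : 0 < T -> 1 <= r ->
  (j < N)%N -> graded_mesh T r N j < graded_mesh T r N j.+1.
Proof.
move=> T0 r1 jN; have N0 : 0 < N%:R :> R by rewrite ltr0n (leq_trans _ jN).
rewrite /graded_mesh ltr_pM2l //; apply: gt0_ltr_powR.
- lra.
- by rewrite nnegrE divr_ge0.
- by rewrite nnegrE divr_ge0.
- by rewrite ltr_pM2r ?invr_gt0 // ltr_nat.
Qed.

(** The function x^r is convex for r >= 1, which is used at a midpoint. *)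
Lemma graded_mesh_tau_le (R : realType) (T r : R) (N j : nat) : 0 < T -> 1 <= r ->
  graded_mesh T r N j.+1 - graded_mesh T r N j
  <= graded_mesh T r N j.+2 - graded_mesh T r N j.+1.
Proof.
move=> T0 r1; rewrite /graded_mesh -!mulrBr ler_pM2l //.
pose x (i : nat) : R := i%:R / N%:R.
have x0 i : x i \in `[0, +oo[%classic.
  by rewrite inE /= in_itv /= andbT divr_ge0.
have h0 : (0 : R) <= 2^-1 by lra.
have h1 : (2^-1 : R) <= 1 by lra.
have xE : x j.+1 = 2^-1 * x j + (1 - 2^-1) * x j.+2.
  by rewrite /x mulrA mulrA -mulrDl; congr (_ * _); rewrite -!natr1; field.
have : x j.+1 `^ r <= 2^-1 * x j `^ r + (1 - 2^-1) * x j.+2 `^ r.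
  by rewrite xE; exact: (convex_powR r1 (Itv01 h0 h1) (x0 j) (x0 j.+2)).
rewrite /x; lra.
Qed.

(** One order of the comparison behind [coef_g_diag_ge]. After division by
positive powers it reads al (1 - e) - e >= (al - 2 e) / (2 - al) with
e = 1 - th: the right-hand side is convex in al and the left-hand side is its
chord over [0, 1], the difference being (1 - e) al (1 - al) / (2 - al). *)
Lemma root_term_le (R : realType) (al th tau mu : R) :
  0 < al < 1 -> 0 < th -> 0 < tau -> 0 < mu ->
  th ^+ 2 * (mu / Gamma (1 - al) * (th * tau) `^ (- al)) +
  2 / tau ^+ 2 * (mu / Gamma (3 - al) * th `^ (1 - al) * (th - (1 - al / 2)) *
                  tau `^ (2 - al))
  <= (2 * th - 1) * (mu * (tau^-1 * ((Gamma (1 - al))^-1 *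
                  ((th * tau) `^ (1 - al) / (1 - al))))).
Proof.
move=> al01 th0 tau0 mu0; have /andP[al0 al1] := al01.
have g0 : 0 < Gamma (1 - al) by rewrite Gamma_gt0 //; lra.
rewrite Gamma_3B //; set g := Gamma (1 - al) in g0 *.
rewrite !powRM ?(ltW th0) ?(ltW tau0) //.
have powD (x u v : R) : 0 < x -> x `^ (u + v) = x `^ u * x `^ v.
  by move=> x0; apply: powRD; rewrite (gt_eqF x0) implybT.
have -> : th `^ (1 - al) = th * th `^ (- al) by rewrite powD // powRr1 // ltW.
have -> : tau `^ (1 - al) = tau * tau `^ (- al) by rewrite powD // powRr1 // ltW.
have -> : tau `^ (2 - al) = tau ^+ 2 * tau `^ (- al).
  by rewrite powD // -(powR_mulrn 2) // ltW.
have P0 := powR_gt0 (- al) th0; have S0 := powR_gt0 (- al) tau0.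
set P := th `^ (- al) in P0 *; set S := tau `^ (- al) in S0 *.
rewrite -subr_ge0.
rewrite (_ : _ - _ = mu * P * S / g * th * (th * al / (2 - al))); last first.
  field; rewrite ?gt_eqF //; lra.
have e0 : 0 <= th * al / (2 - al) by rewrite divr_ge0 ?mulr_ge0 ?ltW //; lra.
have d0 : 0 <= mu * P * S / g by rewrite divr_ge0 ?mulr_ge0 // ltW.
by apply: mulr_ge0 => //; apply: mulr_ge0 => //; exact: ltW.
Qed.

(** The kernel of the multi-term Caputo derivative at the point q. *)
Definition caputo_kernel (R : realType) (m : nat) (alpha mu : nat -> R) (q x : R) : R :=
  \sum_(1 <= s < m.+1) mu s / Gamma (1 - alpha s) * (q - x) `^ (- alpha s).

Arguments caputo_kernel {R}.

Section multi_term.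
Context (R : realType) (m : nat) (alpha mu t sigma : nat -> R) (n : nat) (th : R).
Context (mu_gt0 : forall s, (1 <= s <= m)%N -> 0 < mu s).
Context (alpha01 : forall s, (1 <= s <= m)%N -> 0 < alpha s < 1).
Context (t_lt : forall j, (j < n)%N -> t j < t j.+1).
Context (tau_le : forall j, (j.+1 < n)%N -> t j.+1 - t j <= t j.+2 - t j.+1).
Context (n_gt0 : (0 < n)%N) (th01 : 2^-1 < th < 1) (sigmaE : sigma n = 1 - th).
Let Q := tshift t sigma n.
Let g := coef_g m alpha mu t sigma n.
Let kap := caputo_kernel m alpha mu Q.

Let tau0 : 0 < tau t n.
Proof. by rewrite /tau subr_gt0 -{2}(prednK n_gt0) t_lt // prednK. Qed.

Let QE : Q = t n.-1 + th * tau t n.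
Proof. by rewrite /Q /tshift sigmaE /tau; ring. Qed.

Let Q_gt : t n.-1 < Q.
Proof. by have h := th01; rewrite QE ltrDl mulr_gt0 //; lra. Qed.

Let le_sum (F H : nat -> R) : (forall s, (1 <= s <= m)%N -> F s <= H s) ->
  \sum_(1 <= s < m.+1) F s <= \sum_(1 <= s < m.+1) H s.
Proof.
move=> FH; rewrite big_nat_cond [X in _ <= X]big_nat_cond.
by apply: ler_sum => s; rewrite andbT ltnS => /FH.
Qed.

Lemma coef_g_ge i : (i.+1 < n)%N -> kap (t i) <= g i.+1.
Proof.
move=> i_n; apply: le_sum => s sm; rewrite -mulrA ler_wpM2l ?(ltW (mu_gt0 s sm)) //.
by apply: coef_g_al_ge => //; exact: alpha01.
Qed.

Lemma coef_g_le i : (i.+1 < n)%N -> g i.+1 <= kap (t i.+1).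
Proof.
move=> i_n; apply: le_sum => s sm; rewrite -mulrA ler_wpM2l ?(ltW (mu_gt0 s sm)) //.
by apply: coef_g_al_le => //; exact: alpha01.
Qed.

(** Summing [root_term_le] over the orders, the terms that carry no sign add up
to a multiple of the equation for th. *)
Lemma coef_g_diag_ge : Gfun m alpha mu t n th = 0 ->
  th ^+ 2 * kap (t n.-1) <= (2 * th - 1) * g n.
Proof.
move=> root.
rewrite -[leLHS]addr0 -(mulr0 (2 / tau t n ^+ 2)) -root /Gfun /kap /caputo_kernel /g /coef_g.
rewrite !mulr_sumr -big_split /=; apply: le_sum => s sm.
have [h1 h2] := (th01, tau0); have a01 := alpha01 s sm; have mu0 := mu_gt0 s sm.
have -> : Q - t n.-1 = th * tau t n by rewrite QE; ring.
apply: (le_trans (root_term_le _ _ _ _ _ a01 _ tau0 mu0)); first by lra.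
apply: ler_wpM2l; first by lra.
apply: ler_wpM2l; first exact: ltW.
rewrite /coef_g_al ltnn subr0; apply: ler_wpM2l; first by rewrite invr_ge0 ltW.
rewrite /coef_a eqxx -/Q Rintegral_singular_kernel; [|lra|exact: Q_gt].
have -> : Q - t n.-1 = th * tau t n by rewrite QE; ring.
rewrite lerDl; case: ifP => // n1.
have := @coef_b_ge0 R (alpha s) t sigma n a01 t_lt Q_gt n.-2.
have -> : n.-2.+1 = n.-1 by rewrite prednK // -subn1 subn_gt0.
by apply; rewrite prednK.
Qed.

End multi_term.

Section coercive_coefficients.
Context (R : realType) (m : nat) (alpha mu t sigma : nat -> R) (n : nat) (th : R).
Context (mu_gt0 : forall s, (1 <= s <= m)%N -> 0 < mu s).
Context (alpha01 : forall s, (1 <= s <= m)%N -> 0 < alpha s < 1).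
Context (t_lt : forall j, (j < n)%N -> t j < t j.+1).
Context (tau_le : forall j, (j.+1 < n)%N -> t j.+1 - t j <= t j.+2 - t j.+1).
Context (n_gt0 : (0 < n)%N) (th01 : 2^-1 < th < 1) (sigmaE : sigma n = 1 - th).
Context (root : Gfun m alpha mu t n th = 0).
Let g := coef_g m alpha mu t sigma n.
Let kap := caputo_kernel m alpha mu (tshift t sigma n).

Let ge i (i_n : (i.+1 < n)%N) : kap (t i) <= g i.+1.
Proof. by apply: (@coef_g_ge _ _ _ _ _ _ _ th). Qed.

Let le i (i_n : (i.+1 < n)%N) : g i.+1 <= kap (t i.+1).
Proof. by apply: (@coef_g_le _ _ _ _ _ _ _ th). Qed.

Let diag : th ^+ 2 * kap (t n.-1) <= (2 * th - 1) * g n.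
Proof. by apply: (@coef_g_diag_ge _ _ _ _ _ _ _ th). Qed.

Let kap_ge0 x : 0 <= kap x.
Proof.
rewrite /kap /caputo_kernel big_nat_cond; apply: sumr_ge0 => s; rewrite andbT ltnS => sm.
have a01 := alpha01 s sm.
rewrite mulr_ge0 ?powR_ge0 // divr_ge0 ?(ltW (mu_gt0 s sm)) // ltW // Gamma_gt0 //.
lra.
Qed.

Let diag' : kap (t n.-1) <= g n.
Proof.
have h := th01; have := diag; have := kap_ge0 (t n.-1).
set x := kap _; set y := g n => x0 xy.
have : (2 * th - 1) * x <= (2 * th - 1) * y.
  apply: le_trans xy; apply: ler_wpM2r => //; nra.
by rewrite ler_pM2l //; lra.
Qed.

(** For j + 1 < n both weights are separated by k(t_j); the last one dominates
k(t_{n-1}) because 2 th - 1 <= th^2. *)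
Lemma coef_g_nondecreasing j : (1 <= j < n)%N -> g j <= g j.+1.
Proof.
case: j => [//|i] /= i_n; apply: (le_trans (le i i_n)).
move: i_n; rewrite leq_eqVlt => /predU1P[nE|]; last exact: ge.
by have := diag'; rewrite -nE.
Qed.

Lemma coef_g_first_ge : kap (t 0%N) <= g 1%N.
Proof.
have [n1|] := leqP n 1; last exact: ge.
have nE : n = 1%N by apply/eqP; rewrite eqn_leq n1 n_gt0.
by have := diag'; rewrite nE.
Qed.

Lemma coef_g_last : (1 < n)%N -> th ^+ 2 * g n.-1 <= (2 * th - 1) * g n.
Proof.
move=> n1; apply: le_trans diag; apply: ler_wpM2l; first exact: sqr_ge0.
have nE : n.-1 = n.-2.+1 by rewrite prednK // -subn1 subn_gt0.
by rewrite nE; apply: le; rewrite -nE prednK.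
Qed.

End coercive_coefficients.

(** All that the stability argument needs to know about the time discretization. *)
Definition coercive_weights (R : realType) (g : nat -> nat -> R) (th : nat -> R)
    (N : nat) (c : R) : Prop :=
  forall n, (1 <= n <= N)%N ->
    [/\ 2^-1 <= th n <= 1, c <= g n 1%N,
        forall j, (1 <= j < n)%N -> g n j <= g n j.+1 &
        (1 < n)%N -> th n ^+ 2 * g n n.-1 <= (2 * th n - 1) * g n n].

Lemma graded_coef_g_coercive (R : realType) (T : R) (m : nat) (alpha mu : nat -> R)
    (r : R) (N : nat) (th : nat -> R) :
  0 < T -> (0 < m)%N ->
  (forall s, (1 <= s <= m)%N -> 0 < mu s) ->
  (forall s, (1 <= s <= m)%N -> 0 < alpha s < 1) ->
  1 <= r -> (0 < N)%N ->
  (forall n, (1 <= n <= N)%N ->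
    is_sigma_star m alpha mu (graded_mesh T r N) n (th n)) ->
  coercive_weights R
    (coef_g m alpha mu (graded_mesh T r N) (fun n => 1 - th n)) th N
    (caputo_kernel m alpha mu T 0).
Proof.
move=> T0 m0 mu0 al01 r1 N0 hth n nN.
set t := graded_mesh T r N; set sigma := fun n => 1 - th n.
have /andP[n0 nN'] := nN.
have [/andP[th1 thm] root] := hth n nN.
have a1 := al01 1%N m0; have am : 0 < alpha m < 1 by apply: al01; rewrite m0 leqnn.
have th01 : 2^-1 < th n < 1 by lra.
have t_lt j : (j < n)%N -> t j < t j.+1.
  by move=> jn; apply: graded_mesh_lt => //; exact: leq_trans jn nN'.
have tau_le j : (j.+1 < n)%N -> t j.+1 - t j <= t j.+2 - t j.+1.
  by move=> _; exact: graded_mesh_tau_le.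
have t0 : t 0%N = 0.
  by rewrite /t /graded_mesh mul0r powR0 ?mulr0 // gt_eqF //; lra.
have tT : t n <= T.
  rewrite /t /graded_mesh ger_pMr //.
  have : (n%:R / N%:R) `^ r <= 1 `^ r.
    apply: ge0_ler_powR; rewrite ?nnegrE ?divr_ge0 //; first by lra.
    by rewrite ler_pdivrMr ?ltr0n // mul1r ler_nat.
  by rewrite powR1.
have tn1 : 0 <= t n.-1 by rewrite /t /graded_mesh mulr_ge0 ?powR_ge0 // ltW.
have tn : t n.-1 < t n by rewrite -{2}(prednK n0) t_lt // prednK.
have QE : tshift t sigma n = t n.-1 + th n * (t n - t n.-1).
  by rewrite /tshift /sigma; ring.
have Q0 : 0 < tshift t sigma n.
  by rewrite QE ltr_wpDl // mulr_gt0 //; lra.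
have QT : tshift t sigma n <= T.
  have : th n * (t n - t n.-1) <= 1 * (t n - t n.-1) by apply: ler_wpM2r; lra.
  rewrite QE; lra.
split.
- by lra.
- apply: (@le_trans _ _ (caputo_kernel m alpha mu (tshift t sigma n) (t 0%N))); last first.
    exact: (@coef_g_first_ge _ _ _ _ _ _ _ (th n)).
  rewrite /caputo_kernel t0 !subr0 big_nat_cond [leRHS]big_nat_cond.
  apply: ler_sum => s; rewrite andbT ltnS => sm; have a01 := al01 s sm.
  apply: ler_wpM2l.
    by rewrite divr_ge0 ?(ltW (mu0 s sm)) // ltW // Gamma_gt0 //; lra.
  rewrite !powRN lef_pV2 ?posrE ?powR_gt0 //.
  by apply: ge0_ler_powR; rewrite ?nnegrE //; lra.
- by move=> j; apply: (@coef_g_nondecreasing _ _ _ _ _ _ _ (th n)).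
- by apply: (@coef_g_last _ _ _ _ _ _ _ (th n)).
Qed.

(** * Energy inequality and maximum principle *)

(** Abel summation: the increments of the weights are nonnegative and they
multiply nonpositive values. *)
Lemma sum_by_parts_ge (R : realType) (g y : nat -> R) (n : nat) :
  (forall j, (1 <= j <= n)%N -> g j <= g j.+1) ->
  (forall j, (1 <= j <= n)%N -> y j <= 0) ->
  g n.+1 * y n.+1 - g 1%N * y 0%N <= \sum_(1 <= j < n.+2) g j * (y j - y j.-1).
Proof.
elim: n => [|n IH] gm y0; first by rewrite big_nat1; lra.
rewrite big_nat_recr //=.
have nn j : (1 <= j <= n)%N -> (1 <= j <= n.+1)%N by case/andP => -> /leqW.
have H := IH (fun j h => gm j (nn j h)) (fun j h => y0 j (nn j h)).
have : g n.+2 * y n.+1 <= g n.+1 * y n.+1.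
  by apply: ler_wnM2r; [apply: y0|apply: gm]; rewrite /= leqnn.
lra.
Qed.

(** Let b be the claimed bound. If z_n is the first value above b, summation by
parts of the n-th hypothesis for z - b gives
g_{n,n} (z_n - b) + g_{n,1} (b - z_0) <= q, whereas g_{n,1} (b - z_0) >= q. *)
Lemma discrete_max_principle (R : realType) (g : nat -> nat -> R) (z : nat -> R)
    (N : nat) (c q : R) : 0 < c -> 0 <= q ->
  (forall n, (1 <= n <= N)%N -> c <= g n 1%N) ->
  (forall n j, (n <= N)%N -> (1 <= j < n)%N -> g n j <= g n j.+1) ->
  (forall n, (1 <= n <= N)%N -> \sum_(1 <= j < n.+1) g n j * (z j - z j.-1) <= q) ->
  forall n, (n <= N)%N -> z n <= z 0%N + q / c.
Proof.
move=> c0 q0 gc gm gz; set b := z 0%N + q / c.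
have bq : c * (b - z 0%N) = q by rewrite /b; field; rewrite gt_eqF.
have b0 : 0 <= b - z 0%N by rewrite /b addrC addKr divr_ge0 // ltW.
elim/ltn_ind => -[_ _|n IH nN]; first by rewrite -subr_ge0.
have g1 := gc n.+1 nN.
have gn : c <= g n.+1 n.+1.
  apply: (le_trans g1).
  have : forall j, (j <= n)%N -> g n.+1 1%N <= g n.+1 j.+1.
    elim=> [//|j IHj] jn; apply: (le_trans (IHj (ltnW jn))); exact: gm.
  by apply.
rewrite leNgt; apply/negP => zb.
have : g n.+1 n.+1 * (z n.+1 - b) - g n.+1 1%N * (z 0%N - b) <= q.
  apply: le_trans (gz n.+1 nN).
  have -> : \sum_(1 <= j < n.+2) g n.+1 j * (z j - z j.-1) =
      \sum_(1 <= j < n.+2) g n.+1 j * (z j - b - (z j.-1 - b)).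
    by apply: eq_bigr => j _; congr (_ * _); ring.
  apply: (@sum_by_parts_ge R (g n.+1) (fun j => z j - b)) => j /andP[j1 jn].
    by apply: gm => //; rewrite j1.
  by rewrite subr_le0 IH // (leq_trans jn) // ltnW.
have : c * (b - z 0%N) <= g n.+1 1%N * (b - z 0%N) by apply: ler_wpM2r.
have : 0 < g n.+1 n.+1 * (z n.+1 - b).
  by rewrite mulr_gt0 ?subr_gt0 // (lt_le_trans c0).
lra.
Qed.

(** In [energy_estimate], e_j is the squared distance of U^j to the average of
U^{n-1} and U^n with weight th; whence the values at n - 1 and n. *)
Lemma sum_weighted_drop_ge0 (R : realType) (g e : nat -> R) (n : nat) (th D : R) :
  (0 < n)%N -> 2^-1 <= th -> 0 <= g 1%N ->
  (forall j, (1 <= j < n)%N -> g j <= g j.+1) ->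
  ((1 < n)%N -> th ^+ 2 * g n.-1 <= (2 * th - 1) * g n) ->
  (forall j, (j <= n)%N -> 0 <= e j) -> 0 <= D ->
  e n.-1 = th ^+ 2 * D -> e n = (1 - th) ^+ 2 * D ->
  0 <= \sum_(1 <= j < n.+1) g j * (e j.-1 - e j).
Proof.
case: n => [//|n] _ th2 g1 gm gn e0 D0 en' en.
rewrite big_nat_recr //=.
case: n gm gn e0 en en' => [|n] gm gn e0 en en'.
  rewrite big_geq // add0r en en' /=.
  have -> : th ^+ 2 * D - (1 - th) ^+ 2 * D = (2 * th - 1) * D by ring.
  by rewrite !mulr_ge0 //; lra.
have H : g n.+1 * - e n.+1 - g 1%N * - e 0%N <=
    \sum_(1 <= j < n.+2) g j * (- e j - - e j.-1).
  apply: (@sum_by_parts_ge R g (fun j => - e j)) => j /andP[j1 jn].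
    by apply: gm; rewrite j1 ltnS ltnW.
  by rewrite oppr_le0 e0 // (leq_trans jn) // ltnW.
have -> : \sum_(1 <= j < n.+2) g j * (e j.-1 - e j) =
    \sum_(1 <= j < n.+2) g j * (- e j - - e j.-1).
  by apply: eq_bigr => j _; ring.
have := ler_wpM2r D0 (gn isT).
have := mulr_ge0 g1 (e0 0%N isT).
move: H; rewrite [e n.+2]en [e n.+1]en' /=; lra.
Qed.

(** The properties are only required on V: the L^2 and gradient products are not
bilinear on arbitrary functions. *)
Definition semi_inner_product (R : realType) (X : Type) (V : set (X -> R))
    (B : (X -> R) -> (X -> R) -> R) : Prop :=
  [/\ V (fun=> 0),
      forall (a : R) u v, V u -> V v -> V (fun x => a * u x + v x),
      forall (a : R) u v w, V u -> V v -> V w ->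
        B (fun x => a * u x + v x) w = a * B u w + B v w,
      forall u v, V u -> V v -> B u v = B v u &
      forall u, V u -> 0 <= B u u].

Section energy.
Context (R : realType) (X : Type) (V : set (X -> R)) (B : (X -> R) -> (X -> R) -> R).
Context (HB : semi_inner_product R X V B).

Let V0 : V (fun=> 0). Proof. by have [] := HB. Qed.
Let VD (a : R) u v : V u -> V v -> V (fun x => a * u x + v x).
Proof. by have [_ h _ _ _] := HB; exact: h. Qed.
Let BD (a : R) u v w : V u -> V v -> V w ->
  B (fun x => a * u x + v x) w = a * B u w + B v w.
Proof. by have [_ _ h _ _] := HB; exact: h. Qed.
Let BC u v : V u -> V v -> B u v = B v u.
Proof. by have [_ _ _ h _] := HB; exact: h. Qed.

Lemma form_lin (a b : R) u v w : V u -> V v -> V w ->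
  V (fun x => a * u x + b * v x) /\
  B (fun x => a * u x + b * v x) w = a * B u w + b * B v w.
Proof.
move=> Vu Vv Vw.
have E : (fun x => b * v x) = (fun x => b * v x + 0) by apply/funext => x; rewrite addr0.
have Vb : V (fun x => b * v x) by rewrite E; exact: VD.
split; first exact: VD.
rewrite BD //; congr (_ + _); rewrite E BD //.
have -> : B (fun=> 0) w = 0; last by rewrite addr0.
have := @BD 1 (fun=> 0) (fun=> 0) w V0 V0 Vw.
have -> : (fun _ : X => 1 * (0:R) + 0) = (fun=> 0) by apply/funext => x; rewrite mulr0 addr0.
by rewrite mul1r => h; lra.
Qed.

Lemma form_comb_sq (a b : R) u v : V u -> V v ->
  B (fun x => a * u x + b * v x) (fun x => a * u x + b * v x) =
  a ^+ 2 * B u u + 2 * (a * b) * B u v + b ^+ 2 * B v v.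
Proof.
move=> Vu Vv; have [Vw _] := form_lin a b u v u Vu Vv Vu.
rewrite (form_lin a b u v _ Vu Vv Vw).2.
rewrite (BC u) // (BC v _ _ Vw) //.
rewrite (form_lin a b u v u Vu Vv Vu).2 (form_lin a b u v v Vu Vv Vv).2 (BC v u) //.
ring.
Qed.

Lemma form_sum_diff (g : nat -> R) (U : nat -> X -> R) n w :
  (forall j, (j <= n)%N -> V (U j)) -> V w ->
  V (fun x => \sum_(1 <= j < n.+1) g j * (U j x - U j.-1 x)) /\
  B (fun x => \sum_(1 <= j < n.+1) g j * (U j x - U j.-1 x)) w =
  \sum_(1 <= j < n.+1) g j * (B (U j) w - B (U j.-1) w).
Proof.
move=> VU Vw; elim: n VU => [|n IH] VU.
  have -> : (fun x => \sum_(1 <= j < 1) g j * (U j x - U j.-1 x)) = (fun=> 0).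
    by apply/funext => x; rewrite big_geq.
  split => //; rewrite big_geq //.
  have := @form_lin 0 0 _ _ w V0 V0 Vw.
  have -> : (fun _ : X => 0 * (0:R) + 0 * 0) = (fun=> 0) by apply/funext => x; ring.
  by case=> _ ->; ring.
have [|VS BS] := IH; first by move=> j jn; apply: VU; exact: leqW.
have VUn := VU n.+1 (leqnn _); have VUn' := VU n (leqnSn _).
have [Vd Bd] := form_lin 1 (- 1) _ _ w VUn VUn' Vw.
have -> : (fun x => \sum_(1 <= j < n.+2) g j * (U j x - U j.-1 x)) =
  (fun x => g n.+1 * (1 * U n.+1 x + - 1 * U n x) +
    \sum_(1 <= j < n.+1) g j * (U j x - U j.-1 x)).
  by apply/funext => x; rewrite big_nat_recr //=; ring.
split; first exact: VD.
by rewrite BD // Bd BS [RHS]big_nat_recr //=; ring.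
Qed.

(** The difference of the two sides telescopes into weighted drops of
e_j = B(w - U_j, w - U_j), w being the average. *)
Lemma energy_estimate (g : nat -> R) (U : nat -> X -> R) (n : nat) (th : R) :
  (0 < n)%N -> (forall j, (j <= n)%N -> V (U j)) ->
  2^-1 <= th -> 0 <= g 1%N ->
  (forall j, (1 <= j < n)%N -> g j <= g j.+1) ->
  ((1 < n)%N -> th ^+ 2 * g n.-1 <= (2 * th - 1) * g n) ->
  \sum_(1 <= j < n.+1) g j * (B (U j) (U j) - B (U j.-1) (U j.-1)) <=
  2 * B (fun x => \sum_(1 <= j < n.+1) g j * (U j x - U j.-1 x))
        (fun x => th * U n x + (1 - th) * U n.-1 x).
Proof.
move=> n0 VU th2 g1 gm gn.
have VUn := VU n (leqnn _); have VUn' := VU n.-1 (leq_pred _).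
have [Vw _] := form_lin th (1 - th) _ _ _ VUn VUn' VUn.
set w := fun x => _ in Vw *.
rewrite (form_sum_diff g U n w VU Vw).2.
pose e j := B w w - 2 * B (U j) w + B (U j) (U j).
have eE j : (j <= n)%N -> e j = B (fun x => 1 * w x + - 1 * U j x) (fun x => 1 * w x + - 1 * U j x).
  move=> jn; have VUj := VU j jn.
  by rewrite form_comb_sq // /e (BC (U j) w) //; ring.
have e0 j : (j <= n)%N -> 0 <= e j.
  move=> jn; have VUj := VU j jn; rewrite eE //; have [_ _ _ _ h] := HB; apply: h.
  exact: (form_lin _ _ _ _ w Vw VUj Vw).1.
have [Vd _] := form_lin 1 (- 1) _ _ w VUn VUn' Vw.
pose D := B (fun x => 1 * U n x + - 1 * U n.-1 x) (fun x => 1 * U n x + - 1 * U n.-1 x).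
have D0 : 0 <= D by have [_ _ _ _ h] := HB; exact: h.
have en : e n = (1 - th) ^+ 2 * D.
  rewrite eE // /D form_comb_sq // form_comb_sq //.
  rewrite /w form_comb_sq // (form_lin th (1 - th) _ _ _ VUn VUn' VUn).2 (BC (U n.-1)) //; ring.
have en' : e n.-1 = th ^+ 2 * D.
  rewrite eE ?leq_pred // /D form_comb_sq // form_comb_sq //.
  rewrite /w form_comb_sq // (form_lin th (1 - th) _ _ _ VUn VUn' VUn').2 //; ring.
rewrite -subr_ge0 mulr_sumr -sumrB.
have -> : \sum_(1 <= j < n.+1) (2 * (g j * (B (U j) w - B (U j.-1) w)) -
    g j * (B (U j) (U j) - B (U j.-1) (U j.-1))) =
    \sum_(1 <= j < n.+1) g j * (e j.-1 - e j).
  by apply: eq_bigr => j _; rewrite /e; ring.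
exact: (@sum_weighted_drop_ge0 _ _ _ _ th D).
Qed.

End energy.

Section stability.
Context (R : realType) (X : Type) (V : set (X -> R)) (B : (X -> R) -> (X -> R) -> R).
Context (HB : semi_inner_product R X V B).
Context (g : nat -> nat -> R) (th : nat -> R) (N : nat) (c : R) (c0 : 0 < c).
Context (hg : coercive_weights R g th N c).
Context (U : nat -> X -> R) (VU : forall j, (j <= N)%N -> V (U j)).
Let D n : X -> R := fun x => \sum_(1 <= j < n.+1) g n j * (U j x - U j.-1 x).
Let w n : X -> R := fun x => th n * U n x + (1 - th n) * U n.-1 x.

(** Combines the two mechanisms: the energy inequality turns the hypothesis into
D_N z <= q for z_n = B(U_n, U_n), to which the maximum principle applies. *)
Lemma energy_bound (q : R) : 0 <= q ->
  (forall n, (1 <= n <= N)%N -> 2 * B (D n) (w n) <= q) ->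
  forall n, (n <= N)%N -> B (U n) (U n) <= B (U 0%N) (U 0%N) + q / c.
Proof.
move=> q0 Dq; apply: (@discrete_max_principle R g (fun n => B (U n) (U n)) N c q) => //.
- by move=> n /hg[].
- move=> n j nN /andP[j1 jn].
  have [|_ _ gm _] := hg n; last by apply: gm; rewrite j1.
  by rewrite nN andbT (leq_trans _ jn).
- move=> n nN; have /andP[n0 nN'] := nN.
  have [/andP[th2 _] gc gm gl] := hg n nN.
  apply: le_trans (Dq n nN).
  apply: (@energy_estimate _ _ _ _ HB (g n) U n (th n)) => //.
    by move=> j jn; apply: VU; exact: leq_trans nN'.
  exact: le_trans (ltW c0) gc.
Qed.

(** Convexity of the square of the seminorm. *)
Lemma form_avg_le n (y : R) : (1 <= n <= N)%N ->
  B (U n) (U n) <= y -> B (U n.-1) (U n.-1) <= y -> B (w n) (w n) <= y.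
Proof.
move=> nN un un'; have /andP[n0 nN'] := nN.
have [/andP[th2 th1] _ _ _] := hg n nN.
have V1 := VU n nN'; have V2 := VU n.-1 (leq_trans (leq_pred n) nN').
have [VD _] := form_lin _ _ _ _ HB 1 (- 1) _ _ _ V1 V2 V1.
have h0 : 0 <= B (fun x => 1 * U n x + - 1 * U n.-1 x) (fun x => 1 * U n x + - 1 * U n.-1 x).
  by have [_ _ _ _ h] := HB; exact: h.
rewrite (form_comb_sq _ _ _ _ HB) // in h0.
rewrite /w (form_comb_sq _ _ _ _ HB) //.
set x := B (U n) (U n) in un h0 *; set z := B _ _ in h0 *; set x' := B (U n.-1) _ in un' h0 *.
have : 0 <= th n * (1 - th n) * (x - 2 * z + x') by rewrite !mulr_ge0 //; lra.
have : th n * x <= th n * y by apply: ler_wpM2l; lra.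
have : (1 - th n) * x' <= (1 - th n) * y by apply: ler_wpM2l; lra.
lra.
Qed.

(** With e = c / 2 the term e B(w, w) contributes at most half of the maximum of
the B(U_k, U_k), which is absorbed. *)
Lemma energy_bound_source (F : R) : 0 <= F ->
  (forall n e, (1 <= n <= N)%N -> 0 < e ->
    2 * B (D n) (w n) <= e * B (w n) (w n) + F / e) ->
  forall n, (n <= N)%N -> B (U n) (U n) <= 2 * B (U 0%N) (U 0%N) + 4 * F / c ^+ 2.
Proof.
move=> F0 DF; pose z n := B (U n) (U n).
have z0 n : (n <= N)%N -> 0 <= z n.
  by move=> nN; have [_ _ _ _ h] := HB; apply: h; exact: VU.
pose y := \big[Num.max/0]_(0 <= n < N.+1) z n.
have zy n : (n <= N)%N -> z n <= y.
  by move=> nN; apply: le_bigmax_seq => //; rewrite mem_index_iota.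
have y0 : 0 <= y by apply: le_trans (zy 0%N (leq0n N)); exact: z0.
(* This choice makes the coefficient of the maximum equal to 1/2. *)
pose e := c / 2; have e0 : 0 < e by rewrite divr_gt0.
have bound n : (n <= N)%N -> z n <= z 0%N + (e * y + F / e) / c.
  apply: energy_bound => [|k kN].
    by apply: addr_ge0; [exact: mulr_ge0 (ltW e0) y0|exact: divr_ge0 F0 (ltW e0)].
  have /andP[k0 kN'] := kN.
  apply: le_trans (DF k e kN e0) _; rewrite lerD2r ler_pM2l //.
  by apply: form_avg_le => //; apply: zy => //; exact: leq_trans (leq_pred k) kN'.
have E : (e * y + F / e) / c = y / 2 + 2 * F / c ^+ 2.
  by rewrite /e; field; rewrite gt_eqF.
have P0 : 0 <= 2 * F / c ^+ 2 by apply: divr_ge0; [exact: mulr_ge0|exact: sqr_ge0].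
have ybound : y <= z 0%N + (y / 2 + 2 * F / c ^+ 2).
  rewrite {1}/y big_nat_cond; apply: bigmax_le => [|n].
    by have := z0 0%N (leq0n N); lra.
  by rewrite andbT ltnS -E => /andP[_ nN]; exact: bound.
move=> n nN; apply: le_trans (zy n nN) _; rewrite -/(z 0%N).
have -> : 4 * F / c ^+ 2 = 2 * (2 * F / c ^+ 2) by ring.
by move: P0 ybound; set P := 2 * F / _; lra.
Qed.

End stability.

(** * Null sets and Borel sets of R^d *)

Section null_sets.
Context d (T : measurableType d) (R : realType) (mu : {measure set T -> \bar R}).
Context (N : set T) (mN : measurable N) (N0 : mu N = 0%E).
Import HBNNSimple.

(** No measurability of f is assumed: the integral is a supremum over simple
functions below f, and these can be multiplied by the indicator of the
complement of N. *)
Lemma ge0_integral_setD_null (D : set T) (f : T -> \bar R) :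
  (forall x, D x -> (0 <= f x)%E) ->
  (\int[mu]_(x in D) f x = \int[mu]_(x in D `\` N) f x)%E.
Proof.
move=> f0; apply/eqP; rewrite eq_le; apply/andP; split.
  rewrite ge0_integralE //.
  apply: ge_ereal_sup => _ [h /= hf <-].
  have mNC : measurable (~` N) by exact: measurableC.
  pose h' := proj_nnsfun h mNC.
  have -> : sintegral mu h = sintegral mu h'.
    rewrite -!integralT_nnsfun.
    rewrite (ge0_negligible_integral mN) //=; last first.
    - by move=> x _; rewrite lee_fin.
    - by apply/measurable_EFinP.
    rewrite setTD integral_mkcond; apply: eq_integral => x _.
    by rewrite /= /mindic /patch indicE; case: ifP => _; rewrite ?mulr1 ?mulr0.
  rewrite [leRHS]ge0_integralE; last by move=> x [Dx _]; exact: f0.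
  apply: ereal_sup_ubound; exists h' => //= x.
  rewrite /mindic indicE; have := hf x; rewrite !patchE in_setD in_setC.
  by case: (x \in N); case: (x \in D); rewrite /= ?mulr1 ?mulr0.
rewrite ge0_integralE; last by move=> x [Dx _]; exact: f0.
rewrite [leRHS]ge0_integralE //.
apply: ge_ereal_sup => _ [h /= hf <-].
apply: ereal_sup_ubound; exists h => //= x; apply: le_trans (hf x) _.
rewrite !patchE in_setD; case: ifPn => [/andP[-> _] //|_].
by case: ifPn => // /set_mem /f0.
Qed.

Lemma Rintegral_setD_null (D : set T) (f : T -> R) :
  \int[mu]_(x in D) f x = \int[mu]_(x in D `\` N) f x.
Proof.
rewrite /Rintegral integralE [in RHS]integralE.
by rewrite -!ge0_integral_setD_null.
Qed.

End null_sets.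

Section rV_borel.
Context (R : realType) (d : nat).

Lemma measurable_coord (i : 'I_d) :
  measurable_fun setT (@rV_coord R d i).
Proof.
move=> _ Y mY; apply: sub_sigma_algebra.
by rewrite (bigD1 i) //=; left; exists Y.
Qed.

(** The sigma-algebra is generated by the coordinates, so it contains the cubes
with rational centers and radii 1/(k+1), and an open set is a countable union
of these. *)
Lemma open_measurable_rV (A : set 'rV[R]_d) : open A -> measurable A.
Proof.
move=> oA.
pose box (q : 'rV[rat]_d * nat) : set 'rV[R]_d :=
  [set y | forall j, `|y ord0 j - ratr (q.1 ord0 j)| < q.2.+1%:R^-1].
have mbox q : measurable (box q).
  have -> : box q = \bigcap_(j in [set: 'I_d])
      (@rV_coord R d j @^-1` (ball (ratr (q.1 ord0 j) : R) q.2.+1%:R^-1)).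
    apply/seteqP; split => [y yq j _|y yq j].
      by rewrite /preimage /ball /= distrC; exact: yq.
    by have := yq j I; rewrite /preimage /ball /= distrC.
  apply: fin_bigcap_measurable => // j _.
  rewrite -[X in measurable X]setTI.
  by apply: measurable_coord => //; exact: open_measurable (ball_open _ _).
pose F q := if pselect (box q `<=` A) then box q else set0.
have -> : A = \bigcup_q F q.
  apply/seteqP; split => [x Ax|x [q _]]; last first.
    by rewrite /F; case: pselect => // qA /qA.
  have /nbhs_ballP [e /= e0 eA] := open_nbhs_nbhs (conj oA Ax).
  have [k /ltW ke] : exists k : nat, k.+1%:R^-1 < e / 2.
    have := @near_infty_natSinv_lt R (PosNum (divr_gt0 e0 (ltr0n R 2))).
    by case=> k _ /(_ k (leqnn k)) /= h; exists k.
  have k0 : 0 < k.+1%:R^-1 :> R by rewrite invr_gt0.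
  have rat_close (y e' : R) : 0 < e' -> exists q : rat, `|y - ratr q| < e'.
    move=> e'0; have [|q] := @rat_in_itvoo R (y - e') (y + e'); first lra.
    by rewrite in_itv /= => qy; exists q; rewrite ltr_norml; lra.
  have hq j := rat_close (x ord0 j) _ k0.
  pose q : 'rV[rat]_d := \row_j xget 0 [set q : rat | `|x ord0 j - ratr q| < k.+1%:R^-1].
  have qP j : `|x ord0 j - ratr (q ord0 j)| < k.+1%:R^-1.
    by rewrite mxE; case: xgetP => [y _ //|h]; case: (hq j) => y /h.
  exists (q, k) => //; rewrite /F; case: pselect => [_ //|]; case.
  move=> y yq; apply: eA; split => // i j; rewrite (ord1 i) /ball /=.
  have -> : x ord0 j - y ord0 j =
    (x ord0 j - ratr (q ord0 j)) - (y ord0 j - ratr (q ord0 j)) by ring.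
  apply: (le_lt_trans (ler_normB _ _)).
  apply: (lt_le_trans (ltrD (qP j) (yq j))); rewrite /=.
  by move: ke; move: (k.+1%:R^-1 : R) => z; lra.
apply: countable_bigcupT_measurable; first exact: countableP.
by move=> q; rewrite /F; case: pselect => _ /=; [exact: mbox|exact: measurable0].
Qed.

Lemma closed_measurable_rV (A : set 'rV[R]_d) : closed A -> measurable A.
Proof. by move/closed_openC/open_measurable_rV/measurableC; rewrite setCK. Qed.

Lemma continuous_measurable_rV (v : 'rV[R]_d -> R) :
  continuous v -> measurable_fun setT v.
Proof.
move=> /continuousP cv; apply: (measurability _ (RGenOpens.measurableE R)).
move=> _ [_ [a [b ->] <-]]; rewrite setTI.
by apply: open_measurable_rV; exact/cv/interval_open.
Qed.

End rV_borel.

(** Covers both products: the L^2 one with a single P equal to the identity, the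
gradient one with the partial derivatives, D being then a domain deprived of a
null set on which they are additive. *)
Lemma bounded_semi_inner_product (d : measure_display) (X : measurableType d)
    (R : realType) (mu : {measure set X -> \bar R}) (D : set X) (I : finType)
    (V : set (X -> R)) (P : I -> (X -> R) -> X -> R) :
  measurable D -> (mu D < +oo)%E -> V (fun=> 0) ->
  (forall (a : R) u v, V u -> V v -> V (fun x => a * u x + v x)) ->
  (forall i (a : R) u v x, V u -> V v -> D x ->
     P i (fun x => a * u x + v x) x = a * P i u x + P i v x) ->
  (forall i u, V u -> measurable_fun D (P i u)) ->
  (forall i u, V u -> exists M, forall x, D x -> `|P i u x| <= M) ->
  semi_inner_product R X V
    (fun u v => \int[mu]_(x in D) \sum_i P i u x * P i v x).
Proof.
move=> mD muD V0 VD PD Pm Pb.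
have int u v : V u -> V v ->
    mu.-integrable D (EFin \o (fun x => \sum_i P i u x * P i v x)).
  move=> Vu Vv; apply: measurable_bounded_integrable => //.
    by apply: measurable_sum => i; apply: measurable_funM; exact: Pm.
  have hb i : exists M, forall x, D x -> `|P i u x * P i v x| <= M.
    have [M1 h1] := Pb i u Vu; have [M2 h2] := Pb i v Vv.
    by exists (M1 * M2) => x Dx; rewrite normrM ler_pM ?h1 ?h2.
  have [M hM] := choice hb.
  exists (\sum_i M i); split; rewrite ?num_real // => y /ltW My x Dx /=.
  apply: le_trans My; apply: le_trans (ler_norm_sum _ _ _) _.
  by apply: ler_sum => i _; exact: hM.
split => //.
- move=> a u v w Vu Vv Vw.
  rewrite -RintegralZl ?int // -RintegralD ?int //; last first.
    exact: (@integrableZl _ _ R _ _ mD a _ (int u w Vu Vw)).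
  apply: eq_Rintegral => x /set_mem Dx.
  rewrite mulr_sumr -big_split /=; apply: eq_bigr => i _.
  by rewrite PD //; ring.
- move=> u v _ _; apply: eq_Rintegral => x _.
  by apply: eq_bigr => i _; rewrite mulrC.
- move=> u _; apply: Rintegral_ge0 => x _.
  by apply: sumr_ge0 => i _; rewrite -expr2 sqr_ge0.
Qed.

(** * Barycentric coordinates *)

Lemma lebesgue_rV_bounded_lty (R : realType) (d : nat) (A : set 'rV[R]_d) :
  d = 1%N \/ d = 2%N -> measurable A -> bounded_set A -> (lebesgue_rV d A < +oo)%E.
Proof.
move=> d12 mA [M [_ /(_ (M + 1))]]; rewrite ltrDl ltr01 => /(_ isT) bA.
set r := M + 1 in bA.
have cA x j : A x -> - r <= x ord0 j <= r.
  move=> /bA /= xr; rewrite -ler_norml; apply: le_trans xr.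
  rewrite [X in _ <= X]/Num.norm /= mx_normrE.
  exact: (le_bigmax _ (fun ij : 'I_1 * 'I_d => `|x ij.1 ij.2|) (ord0, j)).
pose I : set (measurableTypeR R) := `[- r, r]%classic.
have mI : measurable I by exact: measurable_itv.
have Ioo : (lebesgue_measure I < +oo)%E.
  by rewrite /I lebesgue_measure_itv /=; case: ifPn => _; rewrite -?EFinD ltry.
case: d12 => ?; subst d.
  apply: (@le_lt_trans _ _ (@lebesgue_measure R I)) => //.
  have -> : lebesgue_rV 1 A = @lebesgue_measure R ((@rV_of1 R 1) @^-1` A) by [].
  apply: (le_measure (@lebesgue_measure R)); rewrite ?inE //.
    by rewrite -[X in measurable X]setTI; exact: measurable_rV_of1.
  by move=> x /= /(cA _ ord0); rewrite mxE /I /= in_itv.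
apply: (@le_lt_trans _ _ ((@lebesgue_measure R \x @lebesgue_measure R)%E (I `*` I))).
  have -> : lebesgue_rV 2 A =
      (@lebesgue_measure R \x @lebesgue_measure R)%E ((@rV_of2 R 2) @^-1` A) by [].
  apply: (le_measure (@lebesgue_measure R \x @lebesgue_measure R)%E); rewrite ?inE //.
  - by rewrite -[X in measurable X]setTI; exact: measurable_rV_of2.
  - exact: measurableX.
  move=> x /= xA; have := cA _ ord0 xA; have := cA _ ord_max xA.
  by rewrite !mxE /I /= !in_itv.
by rewrite product_measure1E // lte_mul_pinfty // ge0_fin_numE.
Qed.


Lemma affine_continuous (R : realType) (d : nat) (w : 'I_d -> R) (w0 : R) :
  continuous (fun x : 'rV[R]_d => w0 + \sum_i x ord0 i * w i).
Proof.
have cs (r : seq 'I_d) : continuous (fun x : 'rV[R]_d => \sum_(i <- r) x ord0 i * w i).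
  elim: r => [|i r IH].
    rewrite (_ : (fun _ => _) = cst 0); first exact: cst_continuous.
    by apply/funext => x; rewrite big_nil.
  rewrite (_ : (fun _ => _) = (fun x : 'rV[R]_d => x ord0 i * w i) +
      (fun x : 'rV[R]_d => \sum_(i <- r) x ord0 i * w i)); last first.
    by apply/funext => x; rewrite big_cons.
  move=> x; apply: continuousD; last exact: IH.
  by apply: continuousM; [exact: coord_continuous|exact: cst_continuous].
by move=> x; apply: (@continuousD _ _ _ (cst w0)); [exact: cst_continuous|exact: cs].
Qed.

Lemma affine_closed (R : realType) (d : nat) (w : 'I_d -> R) (w0 : R) :
  closed [set x : 'rV[R]_d | w0 + \sum_i x ord0 i * w i = 0].
Proof.
apply: (@preimage_closed _ _ (fun x : 'rV[R]_d => w0 + \sum_i x ord0 i * w i) [set 0]).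
  by move=> x _; exact: affine_continuous.
exact: closed_eq.
Qed.

Lemma affine_zero_null (R : realType) (d : nat) (w : 'I_d -> R) (w0 : R) (j : 'I_d) :
  d = 1%N \/ d = 2%N -> w j != 0 ->
  lebesgue_rV d [set x | w0 + \sum_i x ord0 i * w i = 0] = 0%E.
Proof.
move=> d12 wj; have mA := closed_measurable_rV _ _ _ (affine_closed R d w w0).
have solve (b c z : R) : b != 0 -> c + z * b = 0 -> z = - c / b.
  move=> b0 e; apply: (mulIf b0); rewrite divfK //.
  by apply/eqP; rewrite -subr_eq0 opprK addrC e.
case: d12 => ?; subst d.
  have mP : measurable ((@rV_of1 R 1) @^-1` [set x | w0 + \sum_i x ord0 i * w i = 0]).
    by rewrite -[X in measurable X]setTI; exact: measurable_rV_of1.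
  have w00 : w ord0 != 0 by move: wj; rewrite (ord1 j).
  apply: (@subset_measure0 _ _ _ (@lebesgue_measure R) _ [set (- w0 / w ord0 : measurableTypeR R)]) => //.
  - by move=> x /=; rewrite big_ord1 mxE => /(solve _ _ _ w00) ->.
  - exact: lebesgue_measure_set1.
have mP : measurable ((@rV_of2 R 2) @^-1` [set x | w0 + \sum_i x ord0 i * w i = 0]).
  by rewrite -[X in measurable X]setTI; exact: measurable_rV_of2.
have preE x y : [set z : 'rV[R]_2 | w0 + \sum_i z ord0 i * w i = 0] (rV_of2 2 (x, y)) ->
    w0 + x * w ord0 + y * w ord_max = 0.
  rewrite /= big_ord_recr big_ord1 /= !mxE /= addrA.
  by have -> : widen_ord (leqnSn 1) ord0 = ord0 by exact: val_inj.
have [wm0|wm] := eqVneq (w ord_max) 0.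
  have w00 : w ord0 != 0.
    move: wj; case: j => -[|[|//]] jlt.
      by have -> : Ordinal jlt = ord0 by exact: val_inj.
    have -> : Ordinal jlt = ord_max by exact: val_inj.
    by rewrite wm0 eqxx.
  apply: (@subset_measure0 _ _ _ (@lebesgue_measure R \x @lebesgue_measure R)%E _
    ([set (- w0 / w ord0 : measurableTypeR R)] `*` setT)) => //.
  - exact: measurableX.
  - by move=> [x y] /preE; rewrite wm0 mulr0 addr0 => /(solve _ _ _ w00) ->.
  - apply: etrans (product_measure1E _ _ _ _) _ => //.
    have e0 := lebesgue_measure_set1 (- w0 / w ord0).
    by apply: etrans (congr1 (fun z => (z * _)%E) e0) _; rewrite mul0e.
rewrite /lebesgue_rV /pushforward /= /product_measure1.
apply: integral0_eq => x _ /=.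
have mX : measurable (xsection ((@rV_of2 R 2) @^-1` [set x | w0 + \sum_i x ord0 i * w i = 0]) x).
  exact: measurable_xsection.
apply: (@subset_measure0 _ _ _ (@lebesgue_measure R) _
    [set (- (w0 + x * w ord0) / w ord_max : measurableTypeR R)]) => //.
- by move=> y /xsectionP /preE /(solve _ _ _ wm) ->.
- exact: lebesgue_measure_set1.
Qed.

Section barycentric.
Context (R : realType) (d : nat) (S : 'M[R]_(d.+1, d)).

Let M : 'M[R]_(1 + d) := row_mx (const_mx 1) S.

(** The rows of S preceded by a column of ones form a matrix M with
(1, x) = c M whenever x is the combination of the vertices with coefficients c
of sum 1; inverting M recovers c. *)
Definition bary (i : 'I_d.+1) (x : 'rV[R]_d) : R :=
  (row_mx 1%:M x *m invmx (row_mx (const_mx 1) S : 'M[R]_(1 + d))) ord0 i.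

Lemma baryE i x : bary i x = invmx M ord0 i +
  \sum_j x ord0 j * invmx M (rshift 1 j) i.
Proof.
rewrite /bary mxE big_split_ord /= big_ord1 row_mxEl mxE eqxx mul1r.
have -> : lshift d ord0 = ord0 :> 'I_(1 + d) by exact: val_inj.
congr (_ + _).
by apply: eq_bigr => j _; rewrite row_mxEr.
Qed.

Lemma bary_continuous i : continuous (bary i).
Proof.
rewrite (_ : bary i = fun x => invmx M ord0 i + \sum_j x ord0 j * invmx M (rshift 1 j) i); last first.
  by apply/funext => x; exact: baryE.
exact: affine_continuous.
Qed.

Context (y : 'rV[R]_d) (rho : R) (rho0 : 0 < rho).
Context (ballS : [set x | enorm (x - y) <= rho] `<=` simplex S).

Let rowM (c : 'rV[R]_d.+1) : \sum_i c ord0 i = 1 -> row_mx 1%:M (c *m S) = c *m M.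
Proof.
move=> c1; rewrite /M mul_mx_row; congr row_mx.
apply/rowP => k; rewrite !mxE (ord1 k) eqxx -[LHS]c1.
by apply: eq_bigr => i _; rewrite mxE mulr1.
Qed.

(** A nonzero vector in the kernel of M would be a nonconstant affine form or a
nonzero constant vanishing on the simplex, hence on a ball. *)
Lemma simplex_unitmx : M \in unitmx.
Proof.
rewrite -unitmx_tr -row_free_unit -kermx_eq0; apply/negPn/negP => /rowV0Pn[v].
rewrite sub_kermx => /eqP vM /negP; apply.
have hv x : simplex S x -> v ord0 (lshift d ord0) + \sum_j x ord0 j * v ord0 (rshift 1 j) = 0.
  case=> c [c0 _ c1] ->.
  have : (row_mx 1%:M (c *m S) *m v^T) ord0 ord0 = 0.
    by rewrite rowM // -mulmxA -[M]trmxK -trmx_mul vM trmx0 mulmx0 mxE.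
  rewrite mxE big_split_ord /= big_ord1 row_mxEl !mxE eqxx mul1r => h; apply: etrans h.
  by congr (_ + _); apply: eq_bigr => j _; rewrite row_mxEr !mxE.
have en0 : enorm (0 : 'rV[R]_d) = 0.
  by rewrite /enorm big1 ?sqrtr0 // => i _; rewrite mxE expr0n.
have hy := hv y (ballS y _); rewrite /= subrr en0 ltW // in hy.
have {}hy := hy isT.
have vj j : v ord0 (rshift 1 j) = 0.
  have : simplex S (y + rho *: delta_mx ord0 j).
    apply: ballS; rewrite /= addrC addKr /enorm (bigD1 j) //= big1 ?addr0.
      by rewrite !mxE !eqxx mulr1 sqrtr_sqr gtr0_norm.
    by move=> i ij; rewrite !mxE eqxx (negbTE ij) mulr0 expr0n.
  move/hv; under eq_bigr do rewrite mxE mulrDl.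
  rewrite big_split /= addrA hy add0r (bigD1 j) //= big1 ?addr0.
    by rewrite !mxE !eqxx mulr1 => /eqP; rewrite mulf_eq0 gt_eqF //= => /eqP.
  by move=> i ij; rewrite !mxE eqxx (negbTE ij) mulr0 mul0r.
move: hy; rewrite big1 => [|j _]; last by rewrite vj mulr0.
rewrite addr0 => v0; apply/eqP/rowP => k; rewrite mxE.
case: (splitP (k : 'I_(1 + d))) => [k' kk'|k' kk'].
  have -> : k = lshift d ord0 by apply: val_inj; rewrite /= kk' (ord1 k').
  exact: v0.
by have -> : k = rshift 1 k' by apply: val_inj; rewrite /= kk'.
Qed.

Lemma simplexE : simplex S = [set x | forall i, 0 <= bary i x].
Proof.
apply/seteqP; split => [x [c [c0 _ c1] ->] i|x x0].
  by rewrite /bary rowM // mulmxK ?simplex_unitmx.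
pose c : 'rV[R]_d.+1 := row_mx 1%:M x *m invmx M.
have cM : c *m M = row_mx 1%:M x by rewrite /c mulmxKV ?simplex_unitmx.
move: cM; rewrite /M mul_mx_row => /eq_row_mx [c1 cS].
exists c; last by []. split; [exact: x0|by []|].
have := congr1 (fun A : 'M[R]_(1,1) => A ord0 ord0) c1; rewrite !mxE eqxx => h; apply: etrans h.
by apply: eq_bigr => i _; rewrite [X in _ = _ * X]mxE mulr1.
Qed.

(** Each barycentric coordinate is 1 at one vertex and 0 at another one, so its
zero set is a hyperplane and not the whole space. *)
Lemma bary_nonconstant (d0 : (0 < d)%N) i : exists j, invmx M (rshift 1 j) i != 0.
Proof.
apply: contrapT => h.
have W0 j : invmx M (rshift 1 j) i = 0.
  by apply/eqP; apply: contrapT => /negP hj; apply: h; exists j.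
have e l : (l == i)%:R = invmx M ord0 i.
  have := congr1 (fun A : 'M[R]_(1 + d, 1 + d) => A l i) (mulmxV simplex_unitmx).
  rewrite !mxE => <-; rewrite big_split_ord /= big_ord1 row_mxEl mxE mul1r big1.
    by rewrite addr0; have -> : lshift d ord0 = ord0 :> 'I_(1 + d) by exact: val_inj.
  by move=> j _; rewrite W0 mulr0.
have [l li] : exists l : 'I_d.+1, l != i.
  exists (if i == ord0 then ord_max else ord0).
  by case: ifPn => [/eqP ->|]; [rewrite -val_eqE /= -lt0n|rewrite eq_sym].
have := e i; rewrite -(e l) eqxx (negbTE li) => /eqP.
by rewrite oner_eq0.
Qed.

End barycentric.

(** * The finite element space *)

Lemma exists_null (d : measure_display) (X : measurableType d) (R : realType)
    (mu : {measure set X -> \bar R}) (I : finType) (F : I -> set X) :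
  (forall i, measurable (F i) /\ mu (F i) = 0%E) ->
  measurable [set x | exists i, F i x] /\ mu [set x | exists i, F i x] = 0%E.
Proof.
move=> F0; have -> : [set x | exists i, F i x] = \big[setU/set0]_i F i.
  apply/seteqP; split => [x [i Fx]|x].
    by rewrite (bigD1 i) //=; left.
  elim/big_ind: _ => [//|A B hA hB [/hA|/hB]//|i _ Fx]; by exists i.
elim/big_ind : _ => [|A B [mA A0] [mB B0]|i _]; last exact: F0.
  by split; [exact: measurable0|exact: measure0].
split; first exact: measurableU.
by rewrite null_set_setU.
Qed.

(** The hyperplanes supporting the faces are taken whole, which makes the set
closed and measurable at no cost. *)
Definition skeleton (R : realType) (d p : nat) (K : 'I_p -> 'M[R]_(d.+1, d)) : set 'rV[R]_d :=
  [set x | exists k, exists i, bary R d (K k) i x = 0].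

(** The difference quotients along 1/(n+1) are recorded for the sake of
[Vh_partial_measurable]. *)
Lemma partial_locally_affine (R : realType) (d : nat) (v : 'rV[R]_d -> R)
    (q : 'rV[R]_d) (c : R) (x : 'rV[R]_d) (j : 'I_d) :
  (\forall y \near x, v y = \sum_(i < d) q ord0 i * y ord0 i + c) ->
  partial j v x = q ord0 j /\
  n.+1%:R * (v (x + n.+1%:R^-1 *: delta_mx ord0 j) - v x) @[n --> \oo] --> q ord0 j.
Proof.
move=> vq.
have vx := nbhs_singleton vq.
have lin (a : R) : \sum_(i < d) q ord0 i * (a *: delta_mx ord0 j + x) ord0 i =
    a * q ord0 j + \sum_(i < d) q ord0 i * x ord0 i.
  under eq_bigr do rewrite mxE mulrDr.
  rewrite big_split /= (bigD1 j) //= big1 ?addr0 => [|i ij].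
    by rewrite !mxE !eqxx mulr1 mulrC.
  by rewrite !mxE eqxx (negbTE ij) !mulr0.
have near0 : \forall a \near (0 : R), v (a *: delta_mx ord0 j + x) =
    \sum_(i < d) q ord0 i * (a *: delta_mx ord0 j + x) ord0 i + c.
  have cc : (fun a : R => a *: delta_mx ord0 j + x) @ (0 : R) --> x.
    rewrite -[X in _ --> X]add0r -(scale0r (delta_mx ord0 j)).
    by apply: cvgD; [apply: cvgZr_tmp; exact: cvg_id|exact: cvg_cst].
  exact: cc vq.
have quot (a : R) : a != 0 ->
    v (a *: delta_mx ord0 j + x) =
      \sum_(i < d) q ord0 i * (a *: delta_mx ord0 j + x) ord0 i + c ->
    v (a *: delta_mx ord0 j + x) - v x = a * q ord0 j.
  by move=> a0 ->; rewrite vx lin; ring.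
split.
  rewrite /partial /derive; apply/cvg_lim => //.
  apply: cvg_near_cst.
  near=> a.
  have a0 : a != 0 by near: a; exact: nbhs_dnbhs_neq.
  rewrite /= quot //; last by near: a; apply: nbhs_dnbhs; exact: near0.
  by rewrite /GRing.scale /= mulKf.
apply: cvg_near_cst.
have hcvg : (harmonic : nat -> R) @ \oo --> (0 : R) by exact: cvg_harmonic.
have := hcvg _ near0; rewrite /= => near1.
near=> n.
rewrite [x + _]addrC quot ?invr_neq0 // ?pnatr_eq0 //.
  by rewrite mulVKf // pnatr_eq0.
by near: n; exact: near1.
Unshelve. all: by end_near. Qed.

Lemma Vh_lin (R : realType) (d p : nat) (K : 'I_p -> 'M[R]_(d.+1, d)) :
  Vh K (fun=> 0) /\
  (forall (a : R) u v, Vh K u -> Vh K v -> Vh K (fun x => a * u x + v x)).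
Proof.
split.
  split => [x|//|k]; first exact: cst_continuous.
  exists 0, 0 => x _; rewrite addr0 big1 // => i _; by rewrite mxE mul0r.
move=> a u v [cu u0 au] [cv v0 av]; split.
- move=> x; apply: (@continuousD _ _ _ (fun x => a * u x)); last exact: cv.
  by apply: continuousM; [exact: cst_continuous|exact: cu].
- by move=> x xK; rewrite u0 // v0 // mulr0 addr0.
move=> k; have [q [c uq]] := au k; have [q' [c' vq]] := av k.
exists (a *: q + q'), (a * c + c') => x xk; rewrite uq // vq //.
under [in RHS]eq_bigr do rewrite !mxE mulrDl -mulrA.
by rewrite big_split /= -mulr_sumr; ring.
Qed.

Lemma continuous_bounded_on (R : realType) (d : nat) (A : set 'rV[R]_d) (v : 'rV[R]_d -> R) :
  bounded_set A -> continuous v -> exists M, forall x, A x -> `|v x| <= M.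
Proof.
move=> [M [_ /(_ (M + 1))]]; rewrite ltrDl ltr01 => /(_ isT) bA cv.
pose B := [set x : 'rV[R]_d | `|x| <= M + 1].
have cB : compact B.
  apply: bounded_closed_compact.
    exists (M + 1); split; rewrite ?num_real // => z Mz x /= xM.
    exact: le_trans xM (ltW Mz).
  apply: (@preimage_closed _ _ (fun x : 'rV[R]_d => `|x|) [set r | r <= M + 1]).
    by move=> x _; exact: norm_continuous.
  exact: closed_le.
have cvB : {within B, continuous v} by exact: continuous_subspaceT.
have /compact_bounded [M' [_ /(_ (M' + 1))]] := continuous_compact cvB cB.
rewrite ltrDl ltr01 => /(_ isT) h; exists (M' + 1) => x /bA xB.
by apply: h; exists x.
Qed.

Section partition.
Context (R : realType) (d p : nat) (Omega : set 'rV[R]_d) (h kappa : R).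
Context (K : 'I_p -> 'M[R]_(d.+1, d)).
Context (d12 : d = 1%N \/ d = 2%N) (oOmega : open Omega) (bOmega : bounded_set Omega).
Context (hK : quasi_uniform_partition Omega h kappa K).

Let d0 : (0 < d)%N. Proof. by case: d12 => ->. Qed.

Let K_ball k : exists y, [set x | enorm (x - y) <= kappa * h] `<=` simplex (K k).
Proof. by case: hK => -[_ _ _ h1] _ _ _ _; exact: h1. Qed.

Let rho0 : 0 < kappa * h.
Proof. by case: hK => -[h0 _ k0 _] _ _ _ _; rewrite mulr_gt0. Qed.

Let K_simplexE k : simplex (K k) = [set x | forall i, 0 <= bary R d (K k) i x].
Proof. by have [y hy] := K_ball k; exact: (simplexE _ _ _ y _ rho0 hy). Qed.

Let simplex_closed k : closed (simplex (K k)).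
Proof.
rewrite K_simplexE (_ : [set x | _] =
  \bigcap_(i in [set: 'I_d.+1]) [set x | 0 <= bary R d (K k) i x]); last first.
  by apply/seteqP; split => [x hx i _|x hx i]; [exact: hx|exact: hx].
apply: closed_bigI => i _.
apply: (@preimage_closed _ _ (bary R d (K k) i) [set r | 0 <= r]).
  by move=> x _; exact: bary_continuous.
exact: closed_ge.
Qed.

Let covered_closed : closed (covered K).
Proof.
rewrite (_ : covered K = \bigcup_(k in [set: 'I_p]) simplex (K k)); last first.
  by apply/seteqP; split => [x [k hk]|x [k _ hk]]; exists k.
by apply: closed_bigcup; [exact: finite_finset|move=> k _; exact: simplex_closed].
Qed.

Lemma skeleton_null : measurable (skeleton R d p K) /\
  lebesgue_rV d (skeleton R d p K) = 0%E.
Proof.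
apply: (@exists_null _ _ _ _ _ (fun k => [set x | exists i, bary R d (K k) i x = 0])) => k.
apply: (@exists_null _ _ _ _ _ (fun i => [set x | bary R d (K k) i x = 0])) => i.
have -> : [set x | bary R d (K k) i x = 0] =
  [set x | invmx (row_mx (const_mx 1) (K k) : 'M[R]_(1 + d)) ord0 i +
    \sum_j x ord0 j * invmx (row_mx (const_mx 1) (K k) : 'M[R]_(1 + d)) (rshift 1 j) i = 0].
  by apply/seteqP; split => x; rewrite /= baryE.
split; first by apply: closed_measurable_rV; exact: affine_closed.
have [y hy] := K_ball k.
have [j hj] := bary_nonconstant _ _ _ y _ rho0 hy d0 i.
exact: (affine_zero_null _ _ _ _ j).
Qed.

(** Off the skeleton a point is either inside an element, where all barycentric
coordinates are positive, or in the open complement of the elements, where the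
function is 0. The finite list Q of slopes gives the boundedness of the
derivatives. *)
Lemma Vh_locally_affine v : Vh K v -> exists Q : 'I_p -> 'rV[R]_d,
  forall x, ~ skeleton R d p K x -> exists q c,
    (q = 0 \/ exists k, q = Q k) /\
    \forall y \near x, v y = \sum_(i < d) q ord0 i * y ord0 i + c.
Proof.
move=> [_ v0 va].
have [Q hQ] := choice va; exists Q => x xN.
have [[k xk]|xK] := pselect (covered K x).
  have [c hc] := hQ k; exists (Q k), c; split; first by right; exists k.
  have xpos i : 0 < bary R d (K k) i x.
    rewrite lt0r; apply/andP; split; last by move: xk; rewrite K_simplexE; exact.
    by apply/eqP => xi; apply: xN; exists k, i.
  have pos_near i : \forall y \near x, 0 < bary R d (K k) i y.
    exact: (cvgr_gt _ (bary_continuous R d (K k) i x) _ (xpos i)).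
  have := @filter_forall _ _ (fun i y => 0 < bary R d (K k) i y) (nbhs x) _ pos_near.
  move=> H; near=> y; apply: hc; rewrite K_simplexE => i; apply: ltW.
  by move: i; near: y; exact: H.
exists 0, 0; split; first by left.
have : \forall y \near x, ~ covered K y.
  by apply: open_nbhs_nbhs; split => //; exact: closed_openC.
move=> H; near=> y; rewrite v0; last by near: y.
by rewrite addr0 big1 // => i _; rewrite mxE mul0r.
Unshelve. all: by end_near. Qed.

Lemma Vh_partial_lin j (a : R) u v x : Vh K u -> Vh K v -> ~ skeleton R d p K x ->
  partial j (fun x => a * u x + v x) x = a * partial j u x + partial j v x.
Proof.
move=> /Vh_locally_affine [Q hQ] /Vh_locally_affine [Q' hQ'] xN.
have [q [c [_ uq]]] := hQ x xN; have [q' [c' [_ vq]]] := hQ' x xN.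
have : \forall y \near x, a * u y + v y =
    \sum_(i < d) (a *: q + q') ord0 i * y ord0 i + (a * c + c').
  near=> y.
  have -> : u y = \sum_(i < d) q ord0 i * y ord0 i + c by near: y.
  have -> : v y = \sum_(i < d) q' ord0 i * y ord0 i + c' by near: y.
  under [in RHS]eq_bigr do rewrite !mxE mulrDl -mulrA.
  by rewrite big_split /= -mulr_sumr; ring.
move=> /partial_locally_affine - /(_ j) [-> _].
have [-> _] := partial_locally_affine _ _ _ _ _ _ j uq.
have [-> _] := partial_locally_affine _ _ _ _ _ _ j vq.
by rewrite !mxE.
Unshelve. all: by end_near. Qed.

Lemma Vh_partial_bounded j u : Vh K u ->
  exists M, forall x, ~ skeleton R d p K x -> `|partial j u x| <= M.
Proof.
move=> /Vh_locally_affine [Q hQ]; exists (\sum_k `|Q k ord0 j|) => x xN.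
have [q [c [hq uq]]] := hQ x xN.
have [-> _] := partial_locally_affine _ _ _ _ _ _ j uq.
case: hq => [->|[k ->]]; first by rewrite mxE normr0 sumr_ge0.
by rewrite (bigD1 k) //= lerDl sumr_ge0.
Qed.

(** A pointwise limit of difference quotients, which are continuous. *)
Lemma Vh_partial_measurable j u (D : set 'rV[R]_d) : Vh K u -> measurable D ->
  D `<=` ~` skeleton R d p K -> measurable_fun D (partial j u).
Proof.
move=> Vu mD DN; have [cu _ _] := Vu; have [Q hQ] := Vh_locally_affine u Vu.
have ch n : continuous (fun x : 'rV[R]_d =>
    n.+1%:R * (u (x + n.+1%:R^-1 *: delta_mx ord0 j) - u x)).
  move=> x; apply: (@continuousM R 'rV[R]_d (fun=> n.+1%:R)
    (fun x => u (x + n.+1%:R^-1 *: delta_mx ord0 j) - u x)); first exact: cst_continuous.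
  apply: (@continuousB R R^o 'rV[R]_d (fun x => u (x + n.+1%:R^-1 *: delta_mx ord0 j))); last exact: cu.
  apply: (@continuous_comp 'rV[R]_d 'rV[R]_d R
    (fun x => x + n.+1%:R^-1 *: delta_mx ord0 j) u x); last exact: cu.
  by apply: (@continuousD R _ 'rV[R]_d id); [exact: cvg_id|exact: cst_continuous].
apply: (@measurable_fun_cvg _ _ R D
  (fun n x => n.+1%:R * (u (x + n.+1%:R^-1 *: delta_mx ord0 j) - u x))).
  by move=> n; apply: measurable_funTS; exact: continuous_measurable_rV (ch n).
move=> x Dx; have [q [c [_ uq]]] := hQ x (DN x Dx).
by have [-> hn] := partial_locally_affine _ _ _ _ _ _ j uq.
Qed.

Let mOmega : measurable Omega. Proof. exact: open_measurable_rV. Qed.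

Lemma Vh_dotL2_semi_inner_product :
  semi_inner_product R 'rV[R]_d (Vh K) (dotL2 Omega).
Proof.
have [V0 VD] := Vh_lin R d p K.
have -> : dotL2 Omega = (fun u v =>
    \int[lebesgue_rV d]_(x in Omega) \sum_(i < 1) u x * v x).
  apply/funext => u; apply/funext => v; apply: eq_Rintegral => x _.
  by rewrite big_ord1.
apply: (@bounded_semi_inner_product _ _ _ _ Omega 'I_1 (Vh K) (fun=> id)) => //.
- exact: lebesgue_rV_bounded_lty.
- by move=> _ u [cu _ _]; apply: measurable_funTS; exact: continuous_measurable_rV.
- by move=> _ u [cu _ _]; exact: continuous_bounded_on.
Qed.

Lemma Vh_dot_grad_semi_inner_product :
  semi_inner_product R 'rV[R]_d (Vh K) (dot_grad Omega).
Proof.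
have [V0 VD] := Vh_lin R d p K; have [mN N0] := skeleton_null.
have -> : dot_grad Omega = (fun u v =>
    \int[lebesgue_rV d]_(x in Omega `\` skeleton R d p K)
      \sum_(i < d) partial i u x * partial i v x).
  by apply/funext => u; apply/funext => v; exact: Rintegral_setD_null.
have mD : measurable (Omega `\` skeleton R d p K) by exact: measurableD.
apply: (@bounded_semi_inner_product _ _ _ _ _ 'I_d (Vh K) (fun i => @partial R d i)) => //.
- apply: lebesgue_rV_bounded_lty => //.
  by case: bOmega => M [rM hM]; exists M; split => // r Mr x [Ox _]; exact: hM Ox.
- by move=> i a u v x Vu Vv [_ xN]; exact: Vh_partial_lin.
- by move=> i u Vu; apply: Vh_partial_measurable => // x [].
- by move=> i u /(Vh_partial_bounded i) [M hM]; exists M => x [_ /hM].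
Qed.

(** Integrates the square of e v - f divided by e. *)
Lemma L2_young (f v : 'rV[R]_d -> R) (e : R) : 0 < e -> L2 Omega f -> Vh K v ->
  2 * dotL2 Omega f v <= e * dotL2 Omega v v + dotL2 Omega f f / e.
Proof.
move=> e0 [mf f2] [cv _ _].
have mv : measurable_fun Omega v by apply: measurable_funTS; exact: continuous_measurable_rV.
have muD : (lebesgue_rV d Omega < +oo)%E by exact: lebesgue_rV_bounded_lty.
have [M hM] := continuous_bounded_on _ _ _ _ bOmega cv.
have iv : (lebesgue_rV d).-integrable Omega (EFin \o (fun x => v x * v x)).
  apply: measurable_bounded_integrable => //; first exact: measurable_funM.
  exists (M * M); split; rewrite ?num_real // => y /ltW My x Ox /=.
  by apply: le_trans My; rewrite normrM ler_pM ?hM.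
have if2 : (lebesgue_rV d).-integrable Omega (EFin \o (fun x => f x * f x)).
  apply/integrableP; split; first by apply/measurable_EFinP; exact: measurable_funM.
  apply: le_lt_trans f2; rewrite le_eqVlt; apply/orP; left; apply/eqP.
  by apply: eq_integral => x _; rewrite /= ger0_norm ?expr2 // -expr2 sqr_ge0.
have ifv : (lebesgue_rV d).-integrable Omega (EFin \o (fun x => f x * v x)).
  apply: (le_integrable mOmega _ _ (integrableD mOmega if2 iv)).
    by apply/measurable_EFinP; exact: measurable_funM.
  move=> x _ /=; rewrite lee_fin.
  rewrite [leRHS]ger0_norm; last by rewrite addr_ge0 // -expr2 sqr_ge0.
  by rewrite ler_norml; apply/andP; split; nra.
rewrite /dotL2 [_ / e]mulrC -!RintegralZl // -RintegralD //; last 2 first.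
- exact: (@integrableZl _ _ R _ _ mOmega e _ iv).
- exact: (@integrableZl _ _ R _ _ mOmega e^-1 _ if2).
apply: le_Rintegral => //.
- exact: (@integrableZl _ _ R _ _ mOmega 2 _ ifv).
- apply: (integrableD mOmega
    (@integrableZl _ _ R _ _ mOmega e _ iv) (@integrableZl _ _ R _ _ mOmega e^-1 _ if2)).
move=> x _; rewrite -subr_ge0.
have -> : e * (v x * v x) + e^-1 * (f x * f x) - 2 * (f x * v x) =
  e^-1 * (e * v x - f x) ^+ 2 by field; rewrite gt_eqF.
by rewrite mulr_ge0 ?sqr_ge0 // invr_ge0 ltW.
Qed.

End partition.

(** * Stability of the scheme *)

Lemma norm_le_of_sq (R : realType) (z z0 a b C : R) : 0 <= z0 -> 0 <= a -> 0 <= b ->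
  a <= C -> b <= C -> z <= (a * Num.sqrt z0 + b) ^+ 2 ->
  Num.sqrt z <= C * (1 + Num.sqrt z0).
Proof.
move=> z00 a0 b0 aC bC zle.
have s0 := sqrtr_ge0 z0.
have ab0 : 0 <= a * Num.sqrt z0 + b by rewrite addr_ge0 // mulr_ge0.
apply: (@le_trans _ _ (a * Num.sqrt z0 + b)).
  by rewrite -[leRHS]ger0_norm // -sqrtr_sqr ler_wsqrtr.
by have := ler_wpM2r s0 aC; lra.
Qed.

Theorem theorem4p3 (R : realType) (T : R) (m : nat) (alpha mu : nat -> R)
    (m1 M : R)
    (hT : 0 < T) (hm : (0 < m)%N)
    (hmu : forall s, (1 <= s <= m)%N -> 0 < mu s)
    (halpha01 : forall s, (1 <= s <= m)%N -> 0 < alpha s < 1)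
    (halpha : forall s, (1 <= s < m)%N -> alpha s.+1 < alpha s)
    (hm1 : 0 < m1) :
  exists C : R, 0 < C /\
  forall (d : nat) (Omega : set 'rV[R]_d) (a : R -> R) (m2 L : R)
    (f : R -> 'rV[R]_d -> R) (u0 : 'rV[R]_d -> R)
    (h kappa : R) (p : nat) (K : 'I_p -> 'M[R]_(d.+1, d))
    (r : R) (N : nat) (sigma_star : nat -> R)
    (uh0 : 'rV[R]_d -> R) (U : nat -> 'rV[R]_d -> R),
  let t := graded_mesh T r N in
  let sigma := fun n => 1 - sigma_star n in
  d = 1%N \/ d = 2%N ->
  smooth_bounded_domain Omega ->
  (forall x, m1 <= a x <= m2) ->
  (forall x1 x2, `|a x1 - a x2| <= L * `|x1 - x2|) ->
  L2_time T Omega f ->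
  H10 Omega u0 /\ H2 Omega u0 ->
  quasi_uniform_partition Omega h kappa K ->
  1 <= r -> (0 < N)%N ->
  (forall n, (1 <= n <= N)%N ->
    is_sigma_star m alpha mu t n (sigma_star n)) ->
  (forall n, (1 <= n <= N)%N -> L2 Omega (f (tshift t sigma n))) ->
  \big[Num.max/0]_(1 <= j < N.+1) normL2 Omega (f (tshift t sigma j)) <= M ->
  fully_discrete_solution Omega (Vh K) a f m alpha mu N t sigma uh0 U ->
  forall n, (1 <= n <= N)%N ->
    normL2 Omega (U n) <= C * (1 + normL2 Omega (U 0%N)) /\
    norm_grad Omega (U n) <= C * (1 + norm_grad Omega (U 0%N)).
Proof.
pose c := caputo_kernel m alpha mu T 0.
have c0 : 0 < c.
  rewrite /c /caputo_kernel subr0 (big_cat_nat (n := 2)) //=.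
  have pos s : (1 <= s <= m)%N -> 0 < mu s / Gamma (1 - alpha s) * T `^ (- alpha s).
    move=> sm; have := halpha01 s sm => a01.
    rewrite mulr_gt0 ?powR_gt0 // divr_gt0 ?hmu // Gamma_gt0 //; lra.
  rewrite big_nat1 ltr_wpDr ?pos ?hm // big_nat_cond; apply: sumr_ge0 => s.
  by rewrite andbT ltnS => /andP[s1 sm]; rewrite ltW // pos // sm ltnW.
pose b1 := 2 * `|M| / c; pose b2 := M ^+ 2 / (2 * m1 * c).
have b10 : 0 <= b1 by rewrite divr_ge0 ?mulr_ge0 // ltW.
have b20 : 0 <= b2 by rewrite divr_ge0 ?sqr_ge0 // ltW // !mulr_gt0.
have c1 : 2 <= 2 + b1 + b2 by lra.
have c2 : b1 <= 2 + b1 + b2 by lra.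
have c3 : 1 <= 2 + b1 + b2 by lra.
have c4 : 1 + b2 <= 2 + b1 + b2 by lra.
have b21 : 0 <= 1 + b2 by lra.
exists (2 + b1 + b2); split; first by lra.
move=> d Omega a m2 L f u0 h kappa p K r N sigma_star uh0 U t sigma d12
  [_ oOmega _ bOmega _] ha _ _ _ hK r1 N0 hstar fL2 fM [Vuh0 U0 VU' sch1 schn].
have VU j : (j <= N)%N -> Vh K (U j).
  by case: j => [|j] jN; [rewrite U0|exact: VU'].
have hg : coercive_weights R (coef_g m alpha mu t sigma) sigma_star N c.
  exact: graded_coef_g_coercive.
have HL2 := Vh_dotL2_semi_inner_product _ _ _ _ K d12 oOmega bOmega.
have Hgrad := Vh_dot_grad_semi_inner_product _ _ _ _ _ _ _ d12 oOmega bOmega hK.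
pose D n := Dfrac m alpha mu t sigma U n.
pose w n : 'rV[R]_d -> R := fun x => sigma_star n * U n x + (1 - sigma_star n) * U n.-1 x.
have wE n : wavg sigma U n = w n.
  by apply/funext => x; rewrite /wavg /w /sigma; ring.
have scheme n : (1 <= n <= N)%N -> exists2 A, m1 <= A & forall v, Vh K v ->
    dotL2 Omega (D n) v + A * dot_grad Omega (w n) v =
    dotL2 Omega (f (tshift t sigma n)) v.
  case: n => [//|[|n]] nN.
    exists (a (int_Omega Omega (wavg sigma U 1%N))); first by have /andP[] := ha (int_Omega Omega (wavg sigma U 1%N)).
    by move=> v Vv; rewrite -wE; exact: sch1.
  exists (a (int_Omega Omega (extrap t sigma U n.+2))); first by have /andP[] := ha (int_Omega Omega (extrap t sigma U n.+2)).
  by move=> v Vv; rewrite -wE; apply: schn.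
have VUn n : (1 <= n <= N)%N -> Vh K (w n) /\ Vh K (D n).
  move=> /andP[n0 nN]; have V1 := VU n nN; have V2 := VU n.-1 (leq_trans (leq_pred n) nN).
  split; first exact: (form_lin _ _ _ _ HL2 _ _ _ _ _ V1 V2 V1).1.
  apply: (form_sum_diff _ _ _ _ HL2 _ _ _ _ _ V1).1 => j jn.
  by apply: VU; exact: leq_trans nN.
have fF n : (1 <= n <= N)%N ->
    dotL2 Omega (f (tshift t sigma n)) (f (tshift t sigma n)) <= M ^+ 2.
  move=> nN; pose nf j := normL2 Omega (f (tshift t sigma j)).
  have FM : nf n <= M.
    apply: (le_trans (@le_bigmax_seq _ R nat (index_iota 1 N.+1) 0 n xpredT nf _ _)) => //.
    by rewrite mem_index_iota ltnS.
  rewrite /nf /normL2 {nf} in FM; set F := f _ in FM *.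
  have F0 : 0 <= dotL2 Omega F F by apply: Rintegral_ge0 => x _; rewrite -expr2 sqr_ge0.
  have M0 : 0 <= M by apply: le_trans FM; exact: sqrtr_ge0.
  by rewrite -(sqr_sqrtr F0) ler_sqr ?nnegrE ?sqrtr_ge0.
have young n e : (1 <= n <= N)%N -> 0 < e -> forall v, Vh K v ->
    2 * dotL2 Omega (f (tshift t sigma n)) v <= e * dotL2 Omega v v + M ^+ 2 / e.
  move=> nN e0 v Vv.
  apply: le_trans (L2_young _ _ _ _ _ d12 oOmega bOmega _ _ _ e0 (fL2 n nN) Vv) _.
  by rewrite lerD2l ler_pM2r ?invr_gt0 // fF.
move=> n /andP[n0 nN].
have z0 := let: And5 _ _ _ _ h := HL2 in h _ (VU 0%N (leq0n N)).
have g0 := let: And5 _ _ _ _ h := Hgrad in h _ (VU 0%N (leq0n N)).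
have mainL2 : dotL2 Omega (U n) (U n) <=
    (2 * Num.sqrt (dotL2 Omega (U 0%N) (U 0%N)) + b1) ^+ 2.
  apply: le_trans (energy_bound_source _ _ _ _ HL2 _ _ _ _ c0 hg _ VU (M ^+ 2) (sqr_ge0 M) _ n nN) _.
    move=> k e kN e0; have [Vw VD] := VUn k kN; have [A mA sch] := scheme k kN.
    apply: le_trans (young k e kN e0 _ Vw); rewrite -(sch _ Vw).
    have A0 : 0 <= A := le_trans (ltW hm1) mA.
    have gw : 0 <= dot_grad Omega (w k) (w k) by have [_ _ _ _ hh] := Hgrad; exact: hh.
    by rewrite (ler_pM2l (ltr0n R 2)) lerDl; exact: mulr_ge0.
  have b1E : b1 ^+ 2 = 4 * M ^+ 2 / c ^+ 2.
    by rewrite /b1 !exprMn real_normK ?num_real // exprVn; ring.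
  have cross := mulr_ge0 (sqrtr_ge0 (dotL2 Omega (U 0%N) (U 0%N))) b10.
  rewrite sqrrD exprMn sqr_sqrtr // b1E; lra.
have maingrad : dot_grad Omega (U n) (U n) <=
    (1 * Num.sqrt (dot_grad Omega (U 0%N) (U 0%N)) + (1 + b2)) ^+ 2.
  have q0 : 0 <= M ^+ 2 / (2 * m1) by rewrite divr_ge0 ?sqr_ge0 // mulr_ge0 // ltW.
  apply: le_trans (energy_bound _ _ _ _ Hgrad _ _ _ _ c0 hg _ VU (M ^+ 2 / (2 * m1)) q0 _ n nN) _.
    move=> k kN; have [Vw VD] := VUn k kN; have [A mA sch] := scheme k kN.
    (* Young's inequality with parameter 2 cancels the square of D_N U. *)
    have := young k 2 kN (ltr0n R 2) _ VD; rewrite -(sch _ VD).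
    have [_ _ _ BC _] := Hgrad; rewrite [X in X <= _ -> _]mulrDr (BC (w k) (D k)) //.
    rewrite lerD2l (BC _ (w k)) //.
    set y := dot_grad Omega (w k) (D k); rewrite -/(D k) => hy.
    have [y0|y0] := leP y 0; first by apply: le_trans q0; rewrite mulr_ge0_le0.
    rewrite ler_pdivlMr ?mulr_gt0 //.
    have : m1 * y <= A * y by rewrite ler_pM2r.
    lra.
  have -> : M ^+ 2 / (2 * m1) / c = b2 by rewrite /b2; field; rewrite !gt_eqF.
  have cross : 0 <= Num.sqrt (dot_grad Omega (U 0%N) (U 0%N)) * (1 + b2).
    by apply: mulr_ge0; [exact: sqrtr_ge0|lra].
  have b2sq := sqr_ge0 b2.
  rewrite mul1r sqrrD sqr_sqrtr //.
  have -> : (1 + b2) ^+ 2 = 1 + 2 * b2 + b2 ^+ 2 by ring.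
  lra.
split.
  exact: (norm_le_of_sq _ _ _ 2 b1 _ z0 (ler0n R 2) b10 c1 c2 mainL2).
exact: (norm_le_of_sq _ _ _ 1 (1 + b2) _ g0 ler01 b21 c3 c4 maingrad).
Qed.
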